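(* Assume the following conditions. (i) There exist positive absolute constants $\xi_1,\xi_2,\xi_3$ such that, for every sufficiently large $n$ and every $\theta\in\Theta_n$, $$P_\star^{(n)}\left[\exp(-\lambda\{\ell_n(\theta)-\ell_n^\star\})\right]\le \exp(-\xi_1\mathcal L_n(\theta)),\qquad P_\star^{(n)}\left[\exp(\lambda\xi_2\{\ell_n(\theta)-\ell_n^\star\})\right]\le \exp(\xi_3\mathcal L_n(\theta)).$$ (ii) There exists an absolute constant $\rho>0$ such that, with $\bar\rho=(1+\rho)/\rho$, for every sufficiently large $n$ and every $k\in[M_n]$ there are constants $R_{n,k}>0$ and $U_{n,k}>0$ with $$\log\mathcal N\left(R_{n,k},\Pi[\Psi]_{n,k},\mathcal D_{1+\rho}\right)\le U_{n,k},\qquad U_{n,k}+\rho R_{n,k}\le(2\bar\rho)^{-1}\check{\mathcal E}_n(k).$$ (iii) There exists an absolute constant $\xi_5>0$ such that, for every sufficiently large $n$ and every $k\in[M_n]$, there are a distribution $Q^*_{n,k}\in\mathcal Q_{n,k}$ and a hyperparameter $\psi^*_{n,k}\in\Psi_{n,k}$ with $$\log\left(\int\exp(\xi_3\mathcal L_n(\theta))\,dQ^*_{n,k}(\theta)\right)\le\xi_5\check{\mathcal E}_n(k),\quad \mathrm{KL}\left(Q^*_{n,k},\Pi_{n,k}(\cdot|\psi^*_{n,k})\right)\le\xi_5\check{\mathcal E}_n(k),\quad \Upsilon_{n,k}(\psi^*_{n,k})\le\xi_5\check{\mathcal E}_n(k).$$ Let $\check\tau_*>0$ and $C_4>0$ be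 absolute constants such that, for every sufficiently large $n$, $$P_\star^{(n)}\left(\check m_n\ge\min\{\check k_n^\dagger(\check\tau_* )+1,M_n\}\right)\ge1-\check\eta_n,\qquad \check\eta_n:=\check k_n^\dagger(\check\tau_* )\exp\left(-C_4\,\check{\mathcal E}_n(\check k_n^\dagger(\check\tau_* ))\right)$$ (under (i)–(iii) such constants exist), and let $\check{\mathcal E}_n^*:=\min\{\check{\mathcal E}_n(k):k\in[M_n],\ k\le\check k_n^\dagger(\check\tau_* )+1\}$. Assume that $\check\eta_n\to0$ as $n\to\infty$. Then for any sequence $(A_n)_{n\in\mathbb N}$ with $A_n\to\infty$, $$P_\star^{(n)}\left[\check Q_n^{\mathrm{ESA}}\left(\mathcal L_n(\theta)\ge A_n(\check{\mathcal E}_n^*+\log M_n)\right)\right]\to0\quad\text{as }n\to\infty.$$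
   Context: Setup. For each $n$, a sample $X^{(n)}$ with values in a measurable space $\mathcal X_n$ is drawn from the true distribution $P_\star^{(n)}$; $P_\star^{(n)}[\cdot]$ denotes expectation and $P_\star^{(n)}(\cdot)$ probability under it. $\mathcal P(\cdot)$ is the set of probability measures on a space; $[m]=\{1,\dots,m\}$. The models are parameter spaces $\Theta_{n,1},\dots,\Theta_{n,M_n}$, each $\theta$ indexing a distribution $P_\theta^{(n)}\in\mathcal P(\mathcal X_n)$, and they are nested: for each $k<M_n$ there is an embedding $T:\Theta_{n,k}\to\Theta_{n,k+1}$ with $P^{(n)}_\theta=P^{(n)}_{T(\theta)}$ for all $\theta\in\Theta_{n,k}$. Put $\Theta_n=\bigcup_{k=1}^{M_n}\Theta_{n,k}$; distributions on $\Theta_{n,k}$ are regarded as distributions on $\Theta_n$. A loss $\ell_n:\mathcal P(\mathcal X_n)\times\mathcal X_n\to[0,\infty)$ is given; write $\ell_n(\theta)=\ell_n(P_\theta^{(n)},X^{(n)})$ and $\ell_n^\star=\ell_n(P_\star^{(n)},X^{(n)})$. The excess risk is $\mathcal L_n(\theta)=P_\star^{(n)}[\ell_n(\theta)-\ell_n^\star]$. $\mathrm{KL}(P_1,P_2)=\int\log(dP_1/dP_2)\,dP_1$ if $P_1\ll P_2$, and $\infty$ otherwise. ''Absolute constant'' means a constant not depending on $n$ or $k$. Empirical variational Bayes. $\lambda>0$ is a fixed constant, and $\rho>0$, $\bar\rho=(1+\rho)/\rho$ are as in condition (ii). For each $k\in[M_n]$ there are a family of priors $\Pi[\Psi]_{n,k}=\{\Pi_{n,k}(\cdot|\psi):\psi\in\Psi_{n,k}\}$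 on $\Theta_{n,k}$, a variational family $\mathcal Q_{n,k}\subset\mathcal P(\Theta_{n,k})$ and a function $\Upsilon_{n,k}:\Psi_{n,k}\to[0,\infty)$. Put $\mathrm{VFE}_{n,k}(Q,\psi)=\frac{\lambda}{\bar\rho}\int\ell_n(\theta)\,dQ(\theta)+\mathrm{KL}(Q,\Pi_{n,k}(\cdot|\psi))$. The pair $(\check Q_{n,k},\check\psi_{n,k})$ is a minimizer of $\mathrm{VFE}_{n,k}(Q,\psi)+\Upsilon_{n,k}(\psi)$ over $\mathcal Q_{n,k}\times\Psi_{n,k}$, and $\mathrm{mVFE\text{-}EB}_n(k)=\mathrm{VFE}_{n,k}(\check Q_{n,k},\check\psi_{n,k})$. Stopping index: $\check m_n=\inf\{k\in[M_n]\setminus\{1\}:\mathrm{mVFE\text{-}EB}_n(k-1)<\mathrm{mVFE\text{-}EB}_n(k)\}\wedge M_n$ (with $\inf\emptyset=\infty$). ESA-EB variational posterior: $\check Q_n^{\mathrm{ESA}}=\sum_{k=1}^{\check m_n}\check\omega_{n,k}\check Q_{n,k}$ with $\check\omega_{n,k}=\exp(-\mathrm{mVFE\text{-}EB}_n(k))/\sum_{k'=1}^{\check m_n}\exp(-\mathrm{mVFE\text{-}EB}_n(k'))$. Excess risk of model $k$: $\check{\mathcal E}_n(k)=\inf_{\psi\in\Psi_{n,k}}\left[-\log\left(\int\exp(-\xi_1\mathcal L_n(\theta))\,d\Pi_{n,k}(\theta|\psi)\right)\right]$, with the same $\xi_1$ as in condition (i). Rényi-type covering number: for $\psi_0,\psi_1\in\Psi_{n,k}$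 let $\mathcal D_{1+\rho}^{\Pi_{n,k}}(\psi_1,\psi_0)=\frac1\rho\log\int\left(\frac{d\Pi_{n,k}(\cdot|\psi_1)}{d\Pi_{n,k}(\cdot|\psi_0)}\right)^{\rho}d\Pi_{n,k}(\cdot|\psi_1)$ if $\Pi_{n,k}(\cdot|\psi_1)\ll\Pi_{n,k}(\cdot|\psi_0)$, and $\infty$ otherwise. $\mathcal N(R,\Pi[\Psi]_{n,k},\mathcal D_{1+\rho})$ is the minimal cardinality of a finite set $\Psi^\bullet\subset\Psi_{n,k}$ such that for every $\psi\in\Psi_{n,k}$ there is $\psi^\bullet\in\Psi^\bullet$ with $\mathcal D_{1+\rho}^{\Pi_{n,k}}(\psi,\psi^\bullet)\le R$. Near-optimal index: for $\tau>0$, $\check k_n^\dagger(\tau)$ is the smallest $k\in[M_n-1]$ with $\check{\mathcal E}_n(k)\le(1+\tau)\check{\mathcal E}_n(k+1)$, and $\check k_n^\dagger(\tau)=M_n$ if there is no such $k$. *)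

(* Defs.v *)
From HB Require Import structures.
From mathcomp Require Import all_boot all_order all_algebra.
From mathcomp Require Import all_classical all_reals all_analysis.
From mathcomp Require Import measurable_realfun.

Set Implicit Arguments.
Unset Strict Implicit.
Unset Printing Implicit Defensive.

Import Order.TTheory GRing.Theory Num.Theory.
Import numFieldNormedType.Exports.

Local Open Scope classical_set_scope.
Local Open Scope ring_scope.
Local Open Scope ereal_scope.
Local Open Scope charge_scope.

Section Divergences.
Context (d : measure_display) (T : measurableType d) (R : realType).

Definition KL (P1 P2 : probability T R) : \bar R :=
  if pselect (P1 `<< P2) then
    \int[P1]_x lne (('d (charge_of_finite_measure P1) '/d P2) x)
  else +oo.

(* The divergence of order 1 + rho, so that the exponent under P1 is rho. *)
Definition renyi (rho : R) (P1 P0 : probability T R) : \bar R :=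
  if pselect (P1 `<< P0) then
    (rho^-1)%:E *
      lne (\int[P1]_x (poweR (('d (charge_of_finite_measure P1) '/d P0) x) rho))
  else +oo.

(* +oo when no finite set is a cover *)
Definition covering_number (Psi : Type) (prior : Psi -> probability T R)
    (rho r : R) : \bar R :=
  ereal_inf [set c | exists (m : nat) (S : set Psi),
    [/\ (S #= `I_m)%card,
        (forall psi, exists2 psi0, S psi0 &
           renyi rho (prior psi) (prior psi0) <= r%:E)
      & c = m%:R%:E]].

End Divergences.

(* The problem at one sample size.  The models are param 1, ..., param nmodels;
   the fields carrying a model index k are arbitrary outside that range.  The
   sample is the identity on obs under the law truth. *)
Record bayes_setup (R : realType) := BayesSetup {
  obs_display : measure_display ;
  obs : measurableType obs_display ;
  truth : probability obs R ;
  nmodels : nat ;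
  nmodels_gt0 : (0 < nmodels)%N ;
  param_display : nat -> measure_display ;
  param : forall k, measurableType (param_display k) ;
  law : forall k, param k -> probability obs R ;
  embed : forall k, param k -> param k.+1 ;
  embed_inj : forall k, (1 <= k < nmodels)%N -> injective (@embed k) ;
  law_embed : forall k, (1 <= k < nmodels)%N ->
    forall theta, law (@embed k theta) = law theta ;
  loss : probability obs R -> obs -> R ;
  loss_ge0 : forall P x, (0 <= loss P x)%R ;
  measurable_loss_truth : measurable_fun [set: obs] (loss truth) ;
  measurable_loss : forall k, (1 <= k <= nmodels)%N ->
    measurable_fun [set: param k * obs]
      (fun z : param k * obs => loss (law z.1) z.2) ;
  hyper : nat -> Type ;
  prior : forall k, hyper k -> probability (param k) R ;
  vfamily : forall k, set (probability (param k) R) ;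
  penalty : forall k, hyper k -> R ;
  penalty_ge0 : forall k psi, (0 <= @penalty k psi)%R }.

Section Setup.
Context (R : realType) (S : bayes_setup R).
Local Notation M := (nmodels S).

(* The union of the models is formed as a disjoint union: every quantity below
   depends on a parameter only through its law, so parameters identified by
   embed are not distinguished. *)
Definition all_params : Type := {k : nat & param S k}.

Definition full_space : set all_params :=
  [set t | (1 <= tag t <= M)%N].

Definition law_of (t : all_params) : probability (obs S) R := law (tagged t).

Definition loss_diff (t : all_params) (x : obs S) : R :=
  (loss (law_of t) x - loss (truth S) x)%R.

Definition excess_risk (t : all_params) : \bar R :=
  \int[truth S]_x (loss_diff t x)%:E.

Definition in_model (k : nat) (theta : param S k) : all_params :=
  existT (fun k => param S k) k theta.

Definition rbar (rho : R) : R := ((1 + rho) / rho)%R.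

Definition vfe (lambda rho : R) (k : nat) (Q : probability (param S k) R)
    (psi : hyper S k) (x : obs S) : \bar R :=
  (lambda / rbar rho)%:E * \int[Q]_theta (loss (law theta) x)%:E
  + KL Q (prior psi).

Definition eb_minimizer (lambda rho : R) (k : nat) (x : obs S)
    (Q : probability (param S k) R) (psi : hyper S k) : Prop :=
  vfamily Q /\
  forall (Q' : probability (param S k) R) (psi' : hyper S k), vfamily Q' ->
    vfe lambda rho Q psi x + (penalty psi)%:E <=
    vfe lambda rho Q' psi' x + (penalty psi')%:E.

Section Posterior.
Context (lambda rho : R).
Context (Qhat : forall k, obs S -> probability (param S k) R).
Context (psihat : forall k, obs S -> hyper S k).
Arguments Qhat : clear implicits.
Arguments psihat : clear implicits.

(* The penalty is not part of the minimal value. *)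
Definition mvfe (k : nat) (x : obs S) : \bar R :=
  vfe lambda rho (Qhat k x) (psihat k x) x.

Definition stop_index (x : obs S) : nat :=
  \big[minn/M]_(2 <= k < M.+1 | mvfe k.-1 x < mvfe k x) k.

(* For lambda, rho > 0, mvfe is valued in [0, +oo], so fine is applied to numbers
   in [0, 1].  Where every mvfe is +oo the weights are 0 / 0 = 0. *)
Definition esa_weight (k : nat) (x : obs S) : R :=
  (fine (expeR (- mvfe k x)) /
   \sum_(1 <= k' < (stop_index x).+1) fine (expeR (- mvfe k' x)))%R.

Definition esa (x : obs S) (A : set all_params) : \bar R :=
  \sum_(1 <= k < (stop_index x).+1)
    (esa_weight k x)%:E * Qhat k x (@in_model k @^-1` A).

End Posterior.

Section ModelRisk.
Context (xi1 : R).

Definition model_risk (k : nat) : \bar R :=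
  ereal_inf [set - lne (\int[prior psi]_theta
                          expeR (- (xi1%:E * excess_risk (in_model theta))))
            | psi in [set: hyper S k]].

Definition near_optimal (tau : R) : nat :=
  \big[minn/M]_(1 <= k < M | model_risk k <= (1 + tau)%:E * model_risk k.+1) k.

Definition best_risk (tau : R) : \bar R :=
  \big[Order.min/+oo]_(1 <= k < M.+1 | (k <= (near_optimal tau).+1)%N)
    model_risk k.

Definition stop_error (tau C4 : R) : \bar R :=
  (near_optimal tau)%:R%:E *
    expeR (- (C4%:E * model_risk (near_optimal tau))).

End ModelRisk.

End Setup.

(* Main.v *)
(* Each variational free energy is bounded below, uniformly over its
   data-dependent prior, by a PAC-Bayes argument: the Donsker-Varadhan inequality
   against that prior, then Hoelder's inequality to replace it by the nearest
   point of a finite Renyi net. On the net, the integral of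
     exp (- lambda * loss difference + xi1 / 2 * risk^+)
   has bounded expectation, so Markov's inequality over all nets costs only a term
   log M + E, where E is the best risk. The ESA weights are Gibbs weights, so the
   weighted mean of the free energies exceeds the free energy of the best model by
   at most log M whenever the stopping index reaches that model; condition (iii)
   bounds this last free energy by O(E). Hence the posterior mean of risk^+ is
   O(E + log M), and Markov's inequality concludes. The exceptional events have
   probability at most eta + 2 exp (- E), and E tends to infinity because eta
   dominates exp (- C4 (1 + tau) E). The positive part is needed because the
   excess risk may be negative when lambda = xi1. *)

Require Import Defs.
From HB Require Import structures.
From mathcomp Require Import all_boot all_order all_algebra.
From mathcomp Require Import all_classical all_reals all_analysis.
From mathcomp Require Import measurable_realfun.
From mathcomp Require Import ring lra zify.

Set Implicit Arguments.
Unset Strict Implicit.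
Unset Printing Implicit Defensive.

Import Order.TTheory GRing.Theory Num.Theory.
Import numFieldNormedType.Exports.

Local Open Scope classical_set_scope.
Local Open Scope ring_scope.
Local Open Scope ereal_scope.

(** * Change of measure: log-densities, the Donsker-Varadhan inequality, Renyi divergence *)

Section ChangeOfMeasure.
Context (d : measure_display) (T : measurableType d) (R : realType).
Implicit Types P Q : probability T R.
Local Open Scope charge_scope.

Lemma integral_prob_cst P (c : \bar R) : \int[P]_x (cst c x) = c.
Proof.
rewrite integral_cst// -[RHS]mule1; congr (_ * _).
exact: (probability_setT P).
Qed.

(** The logarithm is taken of a version of the density that is finite everywhere. Where the density
    vanishes it takes the default value of [ln], and that set is [P1]-null. The last property is an
    inequality because [P0] may charge that set. *)
Lemma log_density P1 P0 : P1 `<< P0 ->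
  exists l : T -> R, [/\ measurable_fun [set: T] l,
    {ae P1, forall x, ('d (charge_of_finite_measure P1) '/d P0) x
                      = (expR (l x))%:E}
  & forall F : T -> \bar R, measurable_fun [set: T] F -> (forall x, 0 <= F x) ->
    \int[P1]_x (F x * (expR (- l x))%:E) <= \int[P0]_x F x].
Proof.
move=> P10.
pose f := Radon_Nikodym_SigmaFinite.f P1 P0.
have f0 : forall x, 0 <= f x := Radon_Nikodym_SigmaFinite.f_ge0 P10.
have ffin : forall x, f x \is a fin_num :=
  Radon_Nikodym_SigmaFinite.f_fin_num P10.
have mf : measurable_fun [set: T] f.
  exact: (measurable_int _ (Radon_Nikodym_SigmaFinite.f_integrable P10)).
have mff : measurable_fun [set: T] (fine \o f) by exact: measurableT_comp.
have ml : measurable_fun [set: T] (fun x => ln (fine (f x))).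
  exact: measurableT_comp.
exists (fun x => ln (fine (f x))); split => //.
- have mN : measurable [set x | f x = 0].
    rewrite -[X in measurable X]setTI.
    by apply: (mf measurableT [set 0]); exact: emeasurable_set1.
  have PN : P1 [set x | f x = 0] = 0.
    rewrite (Radon_Nikodym_SigmaFinite.f_integral P10 mN).
    by apply: integral0_eq => x /=.
  have /= fg := null_dominates_ae_eq measurableT P10
    (ae_eq_Radon_Nikodym_SigmaFinite P10 measurableT).
  have fN0 : {ae P1, forall x, f x <> 0}.
    exists [set x | f x = 0]; split => // x /=.
    by move/contrapT.
  apply: filterS2 fg fN0 => x fgx fx0.
  rewrite -fgx //; rewrite lnK ?fineK// posrE fine_gt0//.
  by rewrite lt0e f0 ltey_eq ffin !andbT; exact/eqP.
- move=> F mF F0.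
  rewrite -(Radon_Nikodym_SigmaFinite.change_of_variables P10) //; last 2 first.
  + by move=> x; rewrite mule_ge0// lee_fin expR_ge0.
  + apply: emeasurable_funM => //; apply/measurable_EFinP.
    by apply: measurableT_comp => //; exact: measurable_funN.
  apply: ge0_le_integral => //.
  + by move=> x _; rewrite !mule_ge0// lee_fin expR_ge0.
  + apply: emeasurable_funM => //; apply: emeasurable_funM => //.
    apply/measurable_EFinP.
    by apply: measurableT_comp => //; exact: measurable_funN.
  + move=> x _; rewrite -/(f x) -(fineK (ffin x)) fineK//.
    (* Where the density vanishes the left integrand is 0; elsewhere the density cancels
       [expR (- l x)]. *)
    have [f0'|f0'] := eqVneq (f x) 0; first by rewrite f0' mule0.
    rewrite expRN lnK; last first.
      by rewrite posrE fine_gt0// lt0e f0 ltey_eq ffin f0'.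
    rewrite -{2}(fineK (ffin x)) -muleA -EFinM mulVf ?mule1//.
    by rewrite fine_eq0// ffin.
Qed.

(** The tangent to the exponential at the convex combination [w] lies below the graph, and the
    weighted mean of its values at [u] and [v] is [expR w]. *)
Lemma expR_convex (a u v : R) : (0 <= a <= 1)%R ->
  (expR (a * u + (1 - a) * v) <= a * expR u + (1 - a) * expR v)%R.
Proof.
move=> /andP[a0 a1]; set w := (a * u + (1 - a) * v)%R.
have tangent (z : R) : (expR w * (1 + (z - w)) <= expR z)%R.
  have -> : expR z = (expR w * expR (z - w))%R by rewrite -expRD addrC subrK.
  by rewrite ler_wpM2l ?expR_ge0// expR_ge1Dx.
have hu := tangent u; have hv := tangent v.
have -> : expR w = (a * (expR w * (1 + (u - w))) +
    (1 - a) * (expR w * (1 + (v - w))))%R by rewrite /w; ring.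
by rewrite lerD// ler_wpM2l// subr_ge0.
Qed.

Lemma measurable_expRE (f : T -> R) : measurable_fun [set: T] f ->
  measurable_fun [set: T] (fun x => (expR (f x))%:E).
Proof. by move=> mf; apply/measurable_EFinP; exact: measurableT_comp. Qed.

(** A zero integral would make the exponential vanish almost everywhere, hence somewhere, since [P]
    has mass 1. *)
Lemma integral_expR_gt0 P (f : T -> R) : measurable_fun [set: T] f ->
  0 < \int[P]_x (expR (f x))%:E.
Proof.
move=> mf; have mef := measurable_expRE mf.
rewrite lt0e integral_ge0 ?andbT; last by move=> x _; rewrite lee_fin expR_ge0.
apply/eqP => I0.
have [|N [mN PN subN]] := (ae_eq_integral_abs P measurableT mef).1.
  by rewrite -[RHS]I0; apply: eq_integral => x _; rewrite gee0_abs// lee_fin expR_ge0.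
have : P [set: T] <= P N.
  apply: le_measure; rewrite ?inE// => x _; apply: subN => /=.
  move=> /(_ Logic.I) /eqP; rewrite eqe => /eqP ex0.
  by have := expR_gt0 (f x); rewrite ex0 ltxx.
by rewrite PN probability_setT lee_fin ler10.
Qed.

(* The tangent inequality  h + 1 <= l + exp (h - l)  integrated against Q, with
   l the log-density and every term moved to the side where it is nonnegative. *)
Lemma donsker_varadhan Q P (a b : T -> R) :
  measurable_fun [set: T] a -> measurable_fun [set: T] b ->
  (forall x, 0 <= a x)%R -> (forall x, 0 <= b x)%R ->
  \int[P]_x (expR (a x - b x))%:E <= 1 ->
  \int[Q]_x (a x)%:E <= \int[Q]_x (b x)%:E + KL Q P.
Proof.
move=> ma mb a0 b0 hP; rewrite /KL; case: pselect => [QP|nQP] /=; last first.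
  rewrite addey ?leey// gt_eqF//; apply: (@lt_le_trans _ _ 0) => //.
  by apply: integral_ge0 => x _; rewrite lee_fin.
have [l [ml gl hl]] := log_density QP.
set g := 'd _ '/d _ in gl *.
have mg : measurable_fun [set: T] g.
  by apply: (measurable_int P); exact: Radon_Nikodym_integrable.
have gfin x : g x \is a fin_num by exact: Radon_Nikodym_fin_num.
have mlg : measurable_fun [set: T] (fun x => lne (g x)).
  have -> : (fun x => lne (g x)) =
      (fun x => if (fine (g x) <= 0)%R then -oo else (ln (fine (g x)))%:E).
    by apply/funext => x; rewrite -{1}(fineK (gfin x)).
  have mfg : measurable_fun [set: T] (fine \o g) by exact: measurableT_comp.
  apply: measurable_fun_ifT => //.
  - exact: measurable_fun_ler.
  - by apply/measurable_EFinP; exact: measurableT_comp.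
have -> : \int[Q]_x lne (g x) = \int[Q]_x (l x)%:E.
  apply: ae_eq_integral => //; first exact/measurable_EFinP.
  apply: filterS gl => x glx _; rewrite glx lne_EFin ?expR_gt0//.
  by rewrite expRK.
rewrite [X in _ + X]integralE.
have mlE : measurable_fun [set: T] (fun x => (l x)%:E) by exact/measurable_EFinP.
have mlp := measurable_funepos mlE; have mln := measurable_funeneg mlE.
have mexp (h : T -> R) : measurable_fun [set: T] h ->
    measurable_fun [set: T] (fun x => (expR (h x))%:E).
  exact: measurable_expRE.
(* The negative part of [l] is at most [expR (- l)], whose [Q]-integral is at most the [P]-mass 1.
   Being finite, this term can be moved to the other side of the inequality. *)
have lnfin : \int[Q]_x ((fun x => (l x)%:E)^\- x) \is a fin_num.
  rewrite ge0_fin_numE; last by apply: integral_ge0 => x _; exact: funeneg_ge0.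
  apply: (@le_lt_trans _ _ 1) => //; last by rewrite ltry.
  apply: (@le_trans _ _ (\int[Q]_x (cst 1 x * (expR (- l x))%:E))); last first.
    have := hl (cst 1) (measurable_cst _) (fun=> lee01).
    by rewrite integral_prob_cst.
  apply: ge0_le_integral => //.
  - apply: emeasurable_funM => //; apply: mexp; exact: measurable_funN.
  - move=> x _; rewrite funenegE mul1e -EFinN -EFin_max lee_fin ge_max expR_ge0 andbT.
    by apply: le_trans (expR_ge1Dx _); rewrite lerDr.
rewrite addeA leeBrDr//.
have h2 : \int[Q]_x ((expR (a x - b x))%:E * (expR (- l x))%:E) <= 1.
  apply: le_trans hP; apply: hl.
  - by apply: mexp; exact: measurable_funB.
  - by move=> x; rewrite lee_fin expR_ge0.
have maE : measurable_fun [set: T] (EFin \o a) by exact/measurable_EFinP.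
have mbE : measurable_fun [set: T] (EFin \o b) by exact/measurable_EFinP.
have m2 : measurable_fun [set: T]
    (fun x => (expR (a x - b x))%:E * (expR (- l x))%:E).
  apply: emeasurable_funM; apply: mexp; first exact: measurable_funB.
  exact: measurable_funN.
suff : \int[Q]_x (a x)%:E + \int[Q]_x (fun x => (l x)%:E)^\- x + 1 <=
    \int[Q]_x (b x)%:E + \int[Q]_x (fun x => (l x)%:E)^\+ x + 1.
  by rewrite leeD2rE.
apply: (@le_trans _ _ (\int[Q]_x (b x)%:E + \int[Q]_x (fun x => (l x)%:E)^\+ x +
   \int[Q]_x ((expR (a x - b x))%:E * (expR (- l x))%:E))); last first.
  by rewrite leeD2l.
(* With 1 written as an integral, all six terms are integrals of nonnegative functions, and a
   pointwise inequality remains. *)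
have -> : 1 = \int[Q]_x (cst 1 x) by rewrite integral_prob_cst.
rewrite -!ge0_integralD//; first last.
all: try (by move=> x _; rewrite ?adde_ge0 ?mule_ge0 ?lee_fin ?expR_ge0
  ?funepos_ge0 ?funeneg_ge0).
all: try exact: emeasurable_funD.
apply: ge0_le_integral => //.
- by move=> x _; rewrite !adde_ge0 ?lee_fin ?funeneg_ge0//.
- by apply: emeasurable_funD => //; exact: emeasurable_funD.
- by apply: emeasurable_funD => //; exact: emeasurable_funD.
- move=> x _; rewrite funenegE funeposE -EFinN -!EFin_max -EFinM -!EFinD lee_fin.
  rewrite -expRD.
  have h : (a x - b x + 1 <= l x + expR (a x - b x - l x))%R.
    by have := expR_ge1Dx (a x - b x - l x)%R; lra.
  suff : (l x = Num.max (l x) 0 - Num.max (- l x) 0)%R by move: h; lra.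
  by have [l0|l0] := leP (l x) 0%R; have [l1|l1] := leP (- l x)%R 0%R; lra.
Qed.

(* Hoelder's inequality in additive form: the convex combination of f - y + r - l
   and rho * (l - r) with weights 1 / rbar and 1 / (1 + rho) is (f - y) / rbar. *)
Lemma renyi_change_of_measure (rho r y : R) P1 P0 (f : T -> R) :
  (0 < rho)%R -> measurable_fun [set: T] f ->
  renyi rho P1 P0 <= r%:E ->
  \int[P0]_x (expR (f x))%:E <= (expR (y - r))%:E ->
  \int[P1]_x (expR ((f x - y) / rbar rho))%:E <= 1.
Proof.
move=> rho0 mf; rewrite /renyi; case: pselect => [P10|nP10] /=; last by rewrite leye_eq.
have [l [ml gl hl]] := log_density P10.
set g := 'd _ '/d _ in gl *.
have mg : measurable_fun [set: T] g.
  by apply: (measurable_int P0); exact: Radon_Nikodym_integrable.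
have gfin x : g x \is a fin_num by exact: Radon_Nikodym_fin_num.
have mexp (h : T -> R) : measurable_fun [set: T] h ->
    measurable_fun [set: T] (fun x => (expR (h x))%:E).
  exact: measurable_expRE.
have mrl : measurable_fun [set: T] (fun x => rho * l x)%R.
  exact: measurable_funM.
have -> : \int[P1]_x (poweR (g x) rho) = \int[P1]_x (expR (rho * l x))%:E.
  apply: ae_eq_integral => //.
  - have -> : (fun x => poweR (g x) rho) = (fun x => ((fine (g x)) `^ rho)%:E).
      by apply/funext => x; rewrite -{1}(fineK (gfin x)).
    apply/measurable_EFinP; apply: (measurableT_comp (measurable_powR rho)).
    exact: measurableT_comp.
  - exact: mexp.
  - apply: filterS gl => x glx _; rewrite glx /poweR /powR.
    by rewrite gt_eqF ?expR_gt0// expRK.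
move=> hr hf.
have hr2 : \int[P1]_x (expR (rho * l x))%:E <= (expR (rho * r))%:E.
  have i0 := integral_expR_gt0 P1 mrl.
  rewrite -[leLHS]lneK; last first.
    by rewrite in_itv /= leey andbT ltW.
  rewrite -[leRHS]/(expeR (rho * r)%:E) lee_expeR.
  move: hr; rewrite -lee_pdivlMl ?invr_gt0// invrK EFinM.
  by [].
have rb : ((rbar rho)^-1 = rho / (1 + rho))%R by rewrite /rbar invf_div.
have r1 : (0 < 1 + rho)%R by lra.
set al := (rho / (1 + rho))%R in rb.
have al0 : (0 <= al)%R by rewrite divr_ge0 ?ltW.
have al1 : (0 <= 1 - al)%R.
  by rewrite subr_ge0 ler_pdivrMr// mul1r; lra.
have alE : (1 - al = (1 + rho)^-1)%R.
  by rewrite /al; field; rewrite gt_eqF.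
(* The two summands of the convexity bound. Their [P1]-integrals are at most [al] and [1 - al], by
   the moment of [f] under [P0] and by the Renyi bound respectively. *)
pose F1 x := al%:E * ((expR (r - y))%:E * ((expR (f x))%:E * (expR (- l x))%:E)).
pose F2 x := (1 - al)%:E * ((expR (- (rho * r)))%:E * (expR (rho * l x))%:E).
have m0 : measurable_fun [set: T] (fun x => (expR (f x))%:E * (expR (- l x))%:E).
  by apply: emeasurable_funM; apply: mexp => //; exact: measurable_funN.
have m1 : measurable_fun [set: T] F1.
  apply: emeasurable_funM => //.
  by apply: emeasurable_funM => //.
have m2 : measurable_fun [set: T] F2.
  apply: emeasurable_funM => //.
  apply: emeasurable_funM => //.
  exact: mexp.
apply: (@le_trans _ _ (\int[P1]_x (F1 x + F2 x))).
  apply: ge0_le_integral => //.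
  - by apply: mexp; apply: measurable_funM => //; exact: measurable_funB.
  - exact: emeasurable_funD.
  - move=> x _; rewrite /F1 /F2 -!EFinM -EFinD lee_fin -!expRD rb.
    have -> : ((f x - y) * al = al * (r - y + (f x + - l x)) +
        (1 - al) * (- (rho * r) + rho * l x))%R.
      by rewrite alE /al; field; rewrite gt_eqF.
    by apply: expR_convex; lra.
rewrite ge0_integralD//; first last.
- by move=> x _; rewrite !mule_ge0 ?lee_fin ?expR_ge0.
- by move=> x _; rewrite !mule_ge0 ?lee_fin ?expR_ge0.
rewrite !ge0_integralZl ?lee_fin ?expR_ge0//; first last.
all: try (by move=> x _; rewrite ?mule_ge0 ?lee_fin ?expR_ge0).
all: try (by [|exact: mexp|apply: emeasurable_funM => //; exact: mexp]).
have -> : 1 = al%:E * 1 + (1 - al)%:E * 1 :> \bar R.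
  by rewrite !mule1 -EFinD; congr (_%:E); lra.
apply: leeD; apply: lee_pmul => //.
- rewrite mule_ge0 ?lee_fin ?expR_ge0//; apply: integral_ge0 => x _.
  by rewrite mule_ge0 ?lee_fin ?expR_ge0.
- apply: (@le_trans _ _ ((expR (r - y))%:E * (expR (y - r))%:E)).
    rewrite lee_pmul2l ?lte_fin ?expR_gt0//.
    apply: le_trans hf; apply: hl; first exact: mexp.
    by move=> x; rewrite lee_fin expR_ge0.
  by rewrite -EFinM -expRD addrA subrK subrr expR0.
- rewrite mule_ge0 ?lee_fin ?expR_ge0//; apply: integral_ge0 => x _.
  by rewrite lee_fin expR_ge0.
- apply: (@le_trans _ _ ((expR (- (rho * r)))%:E * (expR (rho * r))%:E)).
    by rewrite lee_pmul2l ?lte_fin ?expR_gt0.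
  by rewrite -EFinM -expRD addrC subrr expR0.
Qed.

End ChangeOfMeasure.

(** * Measurability of losses and risks, and exponential moments of the risk under a prior *)

Section Moments.
Context (R : realType) (S : bayes_setup R).
Local Notation M := (nmodels S).
Local Notation P := (truth S).

Lemma measurable_loss_diff k : (1 <= k <= M)%N ->
  measurable_fun [set: param S k * obs S]
    (fun z : param S k * obs S => loss_diff (in_model z.1) z.2).
Proof.
move=> kM; apply: measurable_funB; first exact: measurable_loss.
apply: (measurableT_comp (@measurable_loss_truth R S)).
exact: measurable_snd.
Qed.

Lemma measurable_loss_diff_sample k (theta : param S k) : (1 <= k <= M)%N ->
  measurable_fun [set: obs S] (loss_diff (in_model theta)).
Proof.
move=> kM.
apply: (measurableT_comp (measurable_loss_diff kM)
  (measurable_fun_pair (measurable_cst theta) (@measurable_id _ _ setT))).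
Qed.

Lemma measurable_loss_diff_param k (x : obs S) : (1 <= k <= M)%N ->
  measurable_fun [set: param S k] (fun theta => loss_diff (in_model theta) x).
Proof.
move=> kM.
apply: (measurableT_comp (measurable_loss_diff kM)
  (measurable_fun_pair (@measurable_id _ _ setT) (measurable_cst x))).
Qed.

Lemma measurable_loss_param k (x : obs S) : (1 <= k <= M)%N ->
  measurable_fun [set: param S k] (fun theta => loss (law theta) x).
Proof.
move=> kM.
apply: (measurableT_comp (measurable_loss kM)
  (measurable_fun_pair (@measurable_id _ _ setT) (measurable_cst x))).
Qed.

(** The integral is the difference of the integrals of the positive and negative parts, each
    measurable in the parameter by Tonelli's theorem. *)
Lemma measurable_excess_risk k : (1 <= k <= M)%N ->
  measurable_fun [set: param S k] (fun theta => excess_risk (in_model theta)).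
Proof.
move=> kM; rewrite /excess_risk.
have mD : measurable_fun [set: param S k * obs S]
    (fun z : param S k * obs S => (loss_diff (in_model z.1) z.2)%:E).
  by apply/measurable_EFinP; exact: measurable_loss_diff.
under eq_fun do rewrite integralE.
apply: emeasurable_funB.
- have := @measurable_fun_fubini_tonelli_F _ _ _ _ _ P _ (measurable_funepos mD).
  rewrite /fubini_F => /(_ (fun z => funepos_ge0 _ z)).
  by congr measurable_fun; apply/funext => theta; apply: eq_integral => x _;
    rewrite !funeposE.
- have := @measurable_fun_fubini_tonelli_F _ _ _ _ _ P _ (measurable_funeneg mD).
  rewrite /fubini_F => /(_ (fun z => funeneg_ge0 _ z)).
  by congr measurable_fun; apply/funext => theta; apply: eq_integral => x _;
    rewrite !funenegE.
Qed.

(** The real-valued form of the risk; it agrees with [excess_risk] on the models once the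
    exponential moments are bounded. *)
Definition risk (t : all_params S) : R := fine (excess_risk t).

Lemma measurable_risk k : (1 <= k <= M)%N ->
  measurable_fun [set: param S k] (fun theta => risk (in_model theta)).
Proof. by move=> kM; apply: measurableT_comp => //; exact: measurable_excess_risk. Qed.

Context (lambda xi1 xi2 xi3 : R).
Context (xi1_gt0 : (0 < xi1)%R) (xi3_gt0 : (0 < xi3)%R).
Context (moments : forall t : all_params S, full_space t ->
  \int[P]_x (expR (- (lambda * loss_diff t x)))%:E
    <= expeR (- (xi1%:E * excess_risk t)) /\
  \int[P]_x (expR (lambda * xi2 * loss_diff t x))%:E
    <= expeR (xi3%:E * excess_risk t)).

(* An infinite risk would force one of the exponential moments to vanish. *)
Lemma excess_riskE k (theta : param S k) : (1 <= k <= M)%N ->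
  excess_risk (in_model theta) = (risk (in_model theta))%:E.
Proof.
move=> kM; rewrite fineK//.
have mD := measurable_loss_diff_sample theta kM.
have [] := @moments (in_model theta) kM.
have : 0 < \int[P]_x (expR (- (lambda * loss_diff (in_model theta) x)))%:E.
  by apply: integral_expR_gt0; apply: measurable_funN; exact: measurable_funM.
have : 0 < \int[P]_x (expR (lambda * xi2 * loss_diff (in_model theta) x))%:E.
  by apply: integral_expR_gt0; exact: measurable_funM.
case: (excess_risk (in_model theta)) => [r||] // h1 h2.
- by rewrite gt0_muley ?lte_fin//= => /(lt_le_trans h2); rewrite ltxx.
- by rewrite !gt0_muleNy ?lte_fin//= => _ /(lt_le_trans h1); rewrite ltxx.
Qed.

Lemma moments_real k (theta : param S k) : (1 <= k <= M)%N ->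
  \int[P]_x (expR (- (lambda * loss_diff (in_model theta) x)))%:E
    <= (expR (- (xi1 * risk (in_model theta))))%:E /\
  \int[P]_x (expR (lambda * xi2 * loss_diff (in_model theta) x))%:E
    <= (expR (xi3 * risk (in_model theta)))%:E.
Proof.
move=> kM; have [] := @moments (in_model theta) kM.
by rewrite excess_riskE// -!EFinM -EFinN /=.
Qed.

Lemma prior_expR_risk k (psi : hyper S k) : (1 <= k <= M)%N ->
  \int[prior psi]_theta expeR (- (xi1%:E * excess_risk (in_model theta))) =
  \int[prior psi]_theta (expR (- (xi1 * risk (in_model theta))))%:E.
Proof.
by move=> kM; apply: eq_integral => theta _; rewrite excess_riskE// -EFinM -EFinN.
Qed.

Lemma measurable_prior_expR k : (1 <= k <= M)%N ->
  measurable_fun [set: param S k] (fun theta => (- (xi1 * risk (in_model theta)))%R).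
Proof.
by move=> kM; apply: measurable_funN; apply: measurable_funM => //;
  exact: measurable_risk.
Qed.

(** The prior integral is positive, so its negative logarithm is below [+oo]; [psi] supplies a
    member of the set over which the infimum is taken. *)
Lemma model_risk_lty k (psi : hyper S k) : (1 <= k <= M)%N ->
  model_risk S xi1 k < +oo.
Proof.
move=> kM; apply: (@le_lt_trans _ _ (- lne (\int[prior psi]_theta
    expeR (- (xi1%:E * excess_risk (in_model theta)))))).
  by apply: ereal_inf_lbound; exists psi.
rewrite prior_expR_risk//.
have := integral_expR_gt0 (prior psi) (measurable_prior_expR kM).
case: (\int[_]_theta _) => [r| |]// r0.
by rewrite lne_EFin// -EFinN ltry.
Qed.

(** The infimum over hyperparameters makes the bound uniform in the prior, hence valid at every
    point of a net. *)
Lemma prior_moment_le k (psi : hyper S k) e : (1 <= k <= M)%N ->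
  e%:E <= model_risk S xi1 k ->
  \int[prior psi]_theta (expR (- (xi1 * risk (in_model theta))))%:E
    <= (expR (- e))%:E.
Proof.
move=> kM ek.
have i0 := integral_expR_gt0 (prior psi) (measurable_prior_expR kM).
rewrite -[leLHS]lneK; last by rewrite in_itv /= leey andbT ltW.
rewrite -[leRHS]/(expeR (- e)%:E) lee_expeR -prior_expR_risk// EFinN leeNr.
by apply: le_trans ek _; apply: ereal_inf_lbound; exists psi.
Qed.

(* With s = xi1 * risk, exp (- s + s^+ / 2) <= exp (- s) + exp (- s / 2), and the
   second term is at most the mean of exp (- s + e / 2) and exp (- e / 2). *)
Lemma prior_half_moment_le k (psi : hyper S k) e : (1 <= k <= M)%N ->
  (0 <= e)%R -> e%:E <= model_risk S xi1 k ->
  \int[prior psi]_theta (expR (xi1 / 2 * Num.max (risk (in_model theta)) 0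
      - xi1 * risk (in_model theta)))%:E <= (2 * expR (- (e / 2)))%:E.
Proof.
move=> kM e0 ek.
have me := measurable_expRE (measurable_prior_expR kM).
set h := fun theta : param S k => (expR (- (xi1 * risk (in_model theta))))%:E in me *.
pose c1 := (1 + expR (e / 2) / 2)%R; pose c2 := (expR (- (e / 2)) / 2)%R.
have c10 : (0 <= c1)%R by rewrite addr_ge0// divr_ge0// expR_ge0.
have c20 : (0 <= c2)%R by rewrite divr_ge0// expR_ge0.
have mc : measurable_fun [set: param S k] (fun theta => c1%:E * h theta).
  exact: measurable_funeM.
apply: (@le_trans _ _ (\int[prior psi]_theta (c1%:E * h theta + (cst c2%:E theta)))).
  apply: ge0_le_integral => //.
  - apply: measurable_expRE; apply: measurable_funB.
      apply: measurable_funM => //; apply: measurable_funrpos.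
      exact: measurable_risk.
    by apply: measurable_funM => //; exact: measurable_risk.
  - exact: emeasurable_funD.
  - move=> theta _; rewrite /h -EFinM -EFinD lee_fin.
    set s := risk _; set E1 := expR (- (xi1 * s)).
    have E10 : (0 < E1)%R by exact: expR_gt0.
    have hs : (expR (- (xi1 * s / 2)) <= expR (e / 2) / 2 * E1 + c2)%R.
      have -> : (expR (e / 2) / 2 * E1 + c2 = 2^-1 * expR (e / 2 - xi1 * s) +
          (1 - 2^-1) * expR (- (e / 2)))%R.
        by rewrite /c2 expRD -/E1; field.
      have := @expR_convex R 2^-1 (e / 2 - xi1 * s)%R (- (e / 2))%R.
      have -> : (2^-1 * (e / 2 - xi1 * s) + (1 - 2^-1) * - (e / 2) =
         - (xi1 * s / 2))%R by field.
      by apply; lra.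
    have hp : (0 < expR (- (xi1 * s / 2)))%R by exact: expR_gt0.
    have [s0|s0] := leP s 0%R.
      rewrite mulr0 sub0r -/E1 /c1 mulrDl mul1r -addrA lerDl.
      by rewrite (le_trans _ hs)// ltW.
    have -> : (xi1 / 2 * s - xi1 * s = - (xi1 * s / 2))%R by field.
    by apply: (le_trans hs); rewrite /c1; lra.
rewrite ge0_integralD//; last first.
  by move=> theta _; rewrite mule_ge0// lee_fin expR_ge0.
rewrite ge0_integralZl//; last first.
  by move=> theta _; rewrite lee_fin expR_ge0.
rewrite integral_prob_cst.
apply: (@le_trans _ _ (c1%:E * (expR (- e))%:E + c2%:E)).
  by rewrite leeD2r// lee_wpmul2l//; exact: prior_moment_le.
rewrite -EFinM -EFinD lee_fin /c1 /c2 mulrDl mul1r.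
have -> : (expR (e / 2) / 2 * expR (- e) = expR (- (e / 2)) / 2)%R.
  have -> : (- (e / 2) = e / 2 + - e)%R by field.
  by rewrite expRD; ring.
have : (expR (- e) <= expR (- (e / 2)))%R by rewrite ler_expR; lra.
lra.
Qed.

End Moments.

(** * Lower and upper bounds on variational free energies *)

Section Tempering.
Context (R : realType) (S : bayes_setup R).
Local Notation M := (nmodels S).
Local Notation P := (truth S).
Context (lambda rho xi1 xi2 xi3 : R).
Context (lambda_gt0 : (0 < lambda)%R) (rho_gt0 : (0 < rho)%R).
Context (xi1_gt0 : (0 < xi1)%R) (xi2_gt0 : (0 < xi2)%R) (xi3_gt0 : (0 < xi3)%R).
Context (moments : forall t : all_params S, full_space t ->
  \int[P]_x (expR (- (lambda * loss_diff t x)))%:E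
    <= expeR (- (xi1%:E * excess_risk t)) /\
  \int[P]_x (expR (lambda * xi2 * loss_diff t x))%:E
    <= expeR (xi3%:E * excess_risk t)).

Lemma rbar_gt0 : (0 < rbar rho)%R.
Proof. by rewrite /rbar divr_gt0// addr_gt0. Qed.

(** Only half of [xi1] multiplies the risk: the other half leaves the factor [expR (- (e / 2))] that
    pays for the net. *)
Definition tempered k (x : obs S) (theta : param S k) : R :=
  (xi1 / 2 * Num.max (risk (in_model theta)) 0
   - lambda * loss_diff (in_model theta) x)%R.

Lemma measurable_pos_risk k : (1 <= k <= M)%N -> measurable_fun [set: param S k]
  (fun theta => Num.max (risk (in_model theta)) 0)%R.
Proof. by move=> kM; apply: measurable_funrpos; exact: measurable_risk. Qed.

Lemma measurable_tempered k : (1 <= k <= M)%N ->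
  measurable_fun [set: param S k * obs S] (fun z => tempered z.2 z.1).
Proof.
move=> kM; apply: measurable_funB; apply: measurable_funM => //.
  apply: (measurableT_comp (measurable_pos_risk kM)); exact: measurable_fst.
exact: measurable_loss_diff.
Qed.

Lemma measurable_tempered_param k (x : obs S) : (1 <= k <= M)%N ->
  measurable_fun [set: param S k] (tempered x).
Proof.
move=> kM; apply: measurable_funB; apply: measurable_funM => //.
  exact: measurable_pos_risk.
exact: measurable_loss_diff_param.
Qed.

(** The partition function of the Gibbs measure with exponent [tempered x] and reference measure
    [Q]. *)
Definition evidence k (Q : probability (param S k) R) (x : obs S) : \bar R :=
  \int[Q]_theta (expR (tempered x theta))%:E.

Lemma evidence_ge0 k (Q : probability (param S k) R) x : 0 <= evidence Q x.
Proof. by apply: integral_ge0 => theta _; rewrite lee_fin expR_ge0. Qed.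

Lemma measurable_evidence k (Q : probability (param S k) R) :
  (1 <= k <= M)%N -> measurable_fun [set: obs S] (evidence Q).
Proof.
move=> kM.
have mF : measurable_fun [set: param S k * obs S]
    (fun z : param S k * obs S => (expR (tempered z.2 z.1))%:E).
  by apply: measurable_expRE; exact: measurable_tempered.
by apply: (@measurable_fun_fubini_tonelli_G _ _ _ _ _ Q _ mF) => z; rewrite lee_fin expR_ge0.
Qed.

(** Tonelli's theorem puts the sample expectation inside, where the moment condition turns
    [- lambda] times the loss difference into [- xi1] times the risk; the half-moment bound for the
    prior then applies. *)
Lemma integral_evidence k (psi : hyper S k) e : (1 <= k <= M)%N ->
  (0 <= e)%R -> e%:E <= model_risk S xi1 k ->
  \int[P]_x evidence (prior psi) x <= (2 * expR (- (e / 2)))%:E.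
Proof.
move=> kM e0 ek.
have mF : measurable_fun [set: param S k * obs S]
    (fun z : param S k * obs S => (expR (tempered z.2 z.1))%:E).
  by apply: measurable_expRE; exact: measurable_tempered.
rewrite /evidence -(fubini_tonelli _ mF) => [|z]; last by rewrite lee_fin expR_ge0.
apply: le_trans (prior_half_moment_le xi1_gt0 xi3_gt0 moments psi kM e0 ek).
apply: ge0_le_integral => //.
- by move=> theta _; apply: integral_ge0 => x _; rewrite lee_fin expR_ge0.
- by apply: (measurable_fun_fubini_tonelli_F _ mF) => z; rewrite lee_fin expR_ge0.
- apply: measurable_expRE; apply: measurable_funB; apply: measurable_funM => //.
    exact: measurable_pos_risk.
  exact: measurable_risk.
move=> theta _ /=; rewrite /tempered expRD EFinM.
under eq_integral do rewrite expRD EFinM.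
rewrite ge0_integralZl ?lee_fin ?expR_ge0//; last first.
  apply: measurable_expRE; apply: measurable_funN; apply: measurable_funM => //.
  exact: measurable_loss_diff_sample.
rewrite lee_wpmul2l ?lee_fin ?expR_ge0//.
exact: (moments_real xi1_gt0 xi3_gt0 moments theta kM).1.
Qed.

(** The Donsker-Varadhan inequality for [a] and [b] with [a - b = (tempered x - y) / rbar rho]; the
    change of measure from [psi0] to [psi] bounds the exponential integral of this difference by 1.
    The two losses of the loss difference are put on opposite sides, so that [a] and [b] are
    nonnegative. *)
Lemma tempered_bound k (Q : probability (param S k) R) (psi psi0 : hyper S k)
    (x : obs S) (r y : R) : (1 <= k <= M)%N -> (0 <= y)%R ->
  renyi rho (prior psi) (prior psi0) <= r%:E ->
  evidence (prior psi0) x <= (expR (y - r))%:E ->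
  (xi1 / 2 / rbar rho)%:E *
      \int[Q]_theta (Num.max (risk (in_model theta)) 0)%:E
    + (lambda / rbar rho * loss P x)%:E
  <= vfe lambda rho Q psi x + (y / rbar rho)%:E.
Proof.
move=> kM y0 hr he; have rb0 := rbar_gt0.
have mt := measurable_tempered_param x kM.
have hP := renyi_change_of_measure rho_gt0 mt hr he.
have ml := measurable_loss_param x kM.
have mp := measurable_pos_risk kM.
have lr0 : (0 <= lambda / rbar rho)%R by rewrite divr_ge0// ltW.
have xr0 : (0 <= xi1 / 2 / rbar rho)%R.
  by apply: divr_ge0; [apply: divr_ge0; [exact: ltW|by []]|exact: ltW].
have yr0 : (0 <= y / rbar rho)%R by rewrite divr_ge0// ltW.
have l0 : (0 <= lambda / rbar rho * loss P x)%R by rewrite mulr_ge0// loss_ge0.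
pose a (theta : param S k) := (xi1 / 2 / rbar rho * Num.max (risk (in_model theta)) 0
  + lambda / rbar rho * loss P x)%R.
pose b (theta : param S k) := (lambda / rbar rho * loss (law theta) x
  + y / rbar rho)%R.
have ma : measurable_fun [set: param S k] a.
  by apply: measurable_funD => //; exact: measurable_funM.
have mb : measurable_fun [set: param S k] b.
  by apply: measurable_funD => //; exact: measurable_funM.
have p0 (theta : param S k) : (0 <= Num.max (risk (in_model theta)) 0)%R.
  by rewrite le_max lexx orbT.
have a0 theta : (0 <= a theta)%R by rewrite addr_ge0// mulr_ge0.
have b0 theta : (0 <= b theta)%R by rewrite addr_ge0// mulr_ge0// loss_ge0.
have := @donsker_varadhan _ _ _ Q (prior psi) a b ma mb a0 b0.
have -> : \int[prior psi]_theta (expR (a theta - b theta))%:E <= 1.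
  apply: le_trans hP; rewrite le_eqVlt; apply/orP; left; apply/eqP.
  apply: eq_integral => theta _; congr (expR _)%:E.
  rewrite /a /b /tempered /loss_diff /law_of /=; ring.
move=> /(_ isT); rewrite /vfe.
have mpE : measurable_fun [set: param S k]
  (fun theta => (Num.max (risk (in_model theta)) 0)%:E) by exact/measurable_EFinP.
have mlE : measurable_fun [set: param S k]
  (fun theta => (loss (law theta) x)%:E) by exact/measurable_EFinP.
have -> : \int[Q]_theta (a theta)%:E = (xi1 / 2 / rbar rho)%:E *
      \int[Q]_theta (Num.max (risk (in_model theta)) 0)%:E
    + (lambda / rbar rho * loss P x)%:E.
  transitivity (\int[Q]_theta ((xi1 / 2 / rbar rho)%:E *
      (Num.max (risk (in_model theta)) 0)%:E +
      cst (lambda / rbar rho * loss P x)%:E theta)).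
    by apply: eq_integral => theta _; rewrite EFinD EFinM.
  rewrite ge0_integralD//; last 2 first.
  - by move=> theta _; rewrite mule_ge0 ?lee_fin.
  - exact: measurable_funeM.
  rewrite ge0_integralZl//; first by rewrite integral_prob_cst.
  by move=> theta _; rewrite lee_fin.
have -> : \int[Q]_theta (b theta)%:E = (lambda / rbar rho)%:E *
      \int[Q]_theta (loss (law theta) x)%:E + (y / rbar rho)%:E.
  transitivity (\int[Q]_theta ((lambda / rbar rho)%:E *
      (loss (law theta) x)%:E + cst (y / rbar rho)%:E theta)).
    by apply: eq_integral => theta _; rewrite EFinD EFinM.
  have l0' (theta : param S k) : setT theta -> 0 <= (loss (law theta) x)%:E.
    by rewrite lee_fin loss_ge0.
  rewrite ge0_integralD//; last 2 first.
  - by move=> theta _; rewrite mule_ge0// l0'.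
  - exact: measurable_funeM.
  by rewrite ge0_integralZl// integral_prob_cst.
by rewrite -!addeA [X in _ <= _ + X -> _]addeC.
Qed.

(* W is exp r times the sum of the evidences over an r-net of the priors. *)
Lemma vfe_lower_bound k (psi1 : hyper S k) (r u : R) : (1 <= k <= M)%N ->
  (0 < r)%R -> (0 < u)%R ->
  lne (covering_number (@prior R S k) rho r) <= u%:E ->
  (u + rho * r)%:E <= ((2 * rbar rho)^-1)%:E * model_risk S xi1 k ->
  exists W : obs S -> \bar R,
   [/\ measurable_fun [set: obs S] W, forall x, 0 <= W x,
       \int[P]_x W x <= 4%:E
     & forall (Q : probability (param S k) R) (psi : hyper S k) (x : obs S) (y : R),
         (0 <= y)%R ->
         W x <= (expR y)%:E ->
         (xi1 / 2 / rbar rho)%:E *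
           \int[Q]_theta (Num.max (risk (in_model theta)) 0)%:E
         + (lambda / rbar rho * loss P x)%:E
         <= vfe lambda rho Q psi x + (y / rbar rho)%:E].
Proof.
move=> kM r0 u0 cov hur; have rb0 := rbar_gt0.
have rb20 : (0 < (2 * rbar rho)^-1)%R by rewrite invr_gt0 mulr_gt0.
have mrlty := model_risk_lty xi1_gt0 xi3_gt0 moments psi1 kM.
have [e mrE] : exists e, model_risk S xi1 k = e%:E.
  move: mrlty hur; case: (model_risk S xi1 k) => [e| |]//; first by exists e.
  by rewrite gt0_muleNy ?lte_fin// leeNy_eq.
have hur' : (u + rho * r <= e / (2 * rbar rho))%R.
  by move: hur; rewrite mrE -EFinM lee_fin (mulrC _ e).
(* The hypothesis reads [(u + rho * r) * rbar rho <= e / 2], and both [rbar rho] and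
   [rho * rbar rho = 1 + rho] exceed 1. *)
have {hur'} ure : (u + r <= e / 2)%R.
  have h1 : ((u + rho * r) * (1 + rho) <= e * rho / 2)%R.
    have -> : (e * rho / 2 = e / (2 * rbar rho) * (1 + rho))%R.
      by rewrite /rbar; field; rewrite !gt_eqF ?addr_gt0.
    by rewrite ler_pM2r ?addr_gt0.
  have rr : (0 < rho * r)%R by exact: mulr_gt0.
  have ru : (0 < rho * u)%R by exact: mulr_gt0.
  have rrr : (0 < rho * (rho * r))%R by exact: mulr_gt0.
  rewrite -(ler_pM2l rho_gt0); nra.
have e0 : (0 <= e)%R by lra.
(* The factor 2 gives the strict inequality that extracts a net from the infimum; with the 2 in
   [integral_evidence] it makes up the 4. *)
have [_ [m [C [Ccard net ->]]] mu] :
  exists2 c, [set c | exists (m : nat) (C : set (hyper S k)),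
    [/\ (C #= `I_m)%card,
        (forall psi, exists2 psi0, C psi0 &
           renyi rho (prior psi) (prior psi0) <= r%:E)
      & c = m%:R%:E]] c & c < (2 * expR u)%:E.
  apply: ereal_inf_lt; rewrite -/(covering_number _ _ _).
  apply: (@le_lt_trans _ _ (expR u)%:E); last first.
    by rewrite lte_fin; have := expR_gt0 u; lra.
  have := cov; rewrite -lee_expeR lneK// in_itv /= leey andbT.
  by apply: le_ereal_inf_tmp => _ [n [? [_ _ ->]]]; rewrite lee_fin.
(* An enumeration of the net by the indices below [m], with value [psi1] at all other indices. *)
have [f Cf] : exists f : nat -> hyper S k, C `<=` f @` `I_m.
  move: Ccard; rewrite card_eq_sym => /card_bijP [g [h gh hg]].
  have [m0|m0] := posnP m.
    exists (fun=> psi1) => c Cc; have := h (exist _ c (mem_set Cc)).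
    by case=> i /set_mem /=; rewrite m0.
  exists (fun i => if pselect (`I_m i) is left im then
    sval (g (exist _ i (mem_set im))) else psi1) => c Cc.
  exists (sval (h (exist _ c (mem_set Cc)))).
    by case: (h _) => i /= /set_mem.
  case: pselect => [im|]; last by case: (h _) => i /= /set_mem.
  have -> : exist _ (sval (h (exist _ c (mem_set Cc)))) (mem_set im) =
    h (exist _ c (mem_set Cc)) by apply: val_inj.
  by rewrite hg.
pose W x := \sum_(i <- iota 0 m) (expR r)%:E * evidence (prior (f i)) x.
have mW i : measurable_fun [set: obs S]
    (fun x => (expR r)%:E * evidence (prior (f i)) x).
  by apply: measurable_funeM; exact: measurable_evidence.
have W0 i x : 0 <= (expR r)%:E * evidence (prior (f i)) x.
  by rewrite mule_ge0 ?evidence_ge0// lee_fin expR_ge0.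
exists W; split.
- exact: emeasurable_sum.
- by move=> x; apply: sume_ge0 => i _.
- rewrite ge0_integral_sum//.
  apply: (@le_trans _ _ (\sum_(i <- iota 0 m) (expR r * (2 * expR (- (e / 2))))%:E)).
    apply: lee_sum => i _; rewrite ge0_integralZl ?lee_fin ?expR_ge0//; last 2 first.
    - exact: measurable_evidence.
    - by move=> x _; exact: evidence_ge0.
    rewrite EFinM lee_wpmul2l ?lee_fin ?expR_ge0//.
    by apply: integral_evidence; rewrite ?mrE.
  rewrite sumEFin lee_fin big_const_seq count_predT size_iota iter_addr_0.
  rewrite -(mulr_natl _ m).
  apply: (@le_trans _ _ (2 * expR u * (expR r * (2 * expR (- (e / 2)))))%R).
    rewrite ler_wpM2r ?mulr_ge0 ?expR_ge0//.
    by move: mu; rewrite lte_fin => /ltW.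
  have -> : (2 * expR u * (expR r * (2 * expR (- (e / 2)))) =
      4 * expR (u + r - e / 2))%R by rewrite !expRD; ring.
  have : (expR (u + r - e / 2) <= expR 0)%R by rewrite ler_expR; lra.
  by rewrite expR0; lra.
- move=> Q psi x y y0 Wy.
  have [psi0 /Cf [i im <-] ren] := net psi.
  apply: (tempered_bound Q kM y0 ren).
  have : (expR r)%:E * evidence (prior (f i)) x <= (expR y)%:E.
    apply: le_trans Wy.
    rewrite /W (bigD1_seq i) ?iota_uniq//=; last by rewrite mem_iota.
    by rewrite leeDl// sume_ge0.
  by rewrite expRD expRN EFinM [X in _ -> _ <= X]muleC lee_pdivlMl ?expR_gt0.
Qed.

(** A form of Jensen's inequality: [1 + z <= expR z] at [z = lambda * xi2 * loss_diff - w] is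
    integrated against [Q], where the exponential has integral at most 1. Division by
    [xi2 * rbar rho] restores the scale of the free energy. *)
Lemma vfe_upper_bound k (Q : probability (param S k) R) (x : obs S) (w : R) :
  (1 <= k <= M)%N -> (0 <= w)%R ->
  \int[Q]_theta (expR (lambda * xi2 * loss_diff (in_model theta) x))%:E
    <= (expR w)%:E ->
  (lambda / rbar rho)%:E * \int[Q]_theta (loss (law theta) x)%:E <=
  (lambda / rbar rho * loss P x + w / xi2 / rbar rho)%:E.
Proof.
move=> kM w0 hw; have rb0 := rbar_gt0.
pose a (theta : param S k) := (lambda * xi2 * loss (law theta) x)%R.
pose b := (lambda * xi2 * loss P x + w)%R.
have lx0 : (0 <= lambda * xi2)%R by rewrite mulr_ge0// ltW.
have ml := measurable_loss_param x kM.
have mlE : measurable_fun [set: param S k]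
  (fun theta => (loss (law theta) x)%:E) by exact/measurable_EFinP.
have mD : measurable_fun [set: param S k] (fun theta =>
    (expR (lambda * xi2 * loss_diff (in_model theta) x))%:E).
  by apply: measurable_expRE; apply: measurable_funM => //; exact: measurable_loss_diff_param.
have b0 : (0 <= b)%R by rewrite addr_ge0// mulr_ge0// loss_ge0.
have l0 (theta : param S k) : setT theta -> 0 <= (loss (law theta) x)%:E.
  by rewrite lee_fin loss_ge0.
have : \int[Q]_theta ((lambda * xi2)%:E * (loss (law theta) x)%:E + cst 1 theta) <=
  \int[Q]_theta ((expR (- w))%:E *
     (expR (lambda * xi2 * loss_diff (in_model theta) x))%:E + cst b%:E theta).
  apply: ge0_le_integral => //.
  - by move=> theta _; rewrite adde_ge0// mule_ge0// l0.
  - by apply: emeasurable_funD => //; exact: measurable_funeM.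
  - by apply: emeasurable_funD => //; exact: measurable_funeM.
  - move=> theta _; rewrite -!EFinM -!EFinD lee_fin -expRD.
    have := expR_ge1Dx (- w + lambda * xi2 * loss_diff (in_model theta) x)%R.
    by rewrite /b /loss_diff /law_of /=; lra.
rewrite ge0_integralD//; last 2 first.
- by move=> theta _; rewrite mule_ge0// l0.
- exact: measurable_funeM.
rewrite (ge0_integralZl Q measurableT mlE l0) ?lee_fin//.
rewrite ge0_integralD//; last exact: measurable_funeM.
rewrite ge0_integralZl ?lee_fin ?expR_ge0// !integral_prob_cst.
have lxrb : (0 < lambda * xi2)%R by exact: mulr_gt0.
have : (expR (- w))%:E * \int[Q]_theta
    (expR (lambda * xi2 * loss_diff (in_model theta) x))%:E <= 1.
  apply: (@le_trans _ _ ((expR (- w))%:E * (expR w)%:E)).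
    by rewrite lee_wpmul2l ?lee_fin ?expR_ge0.
  by rewrite -EFinM -expRD addrC subrr expR0.
move=> h1 /le_trans /(_ (leeD2r _ h1)).
rewrite addeC leeD2lE// => h2.
have -> : ((lambda / rbar rho)%:E = ((rbar rho)^-1 / xi2)%:E * (lambda * xi2)%:E :> \bar R).
  rewrite -EFinM; congr (_%:E); field; rewrite !gt_eqF//.
rewrite -muleA; apply: (@le_trans _ _ (((rbar rho)^-1 / xi2)%:E * b%:E)).
  rewrite lee_wpmul2l// lee_fin.
  by apply: divr_ge0; [rewrite invr_ge0|]; exact: ltW.
rewrite -EFinM lee_fin /b.
rewrite le_eqVlt; apply/orP; left; apply/eqP.
by field; rewrite !gt_eqF.
Qed.

(** Tonelli's theorem reduces this to the exponential moment with the positive sign. Through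
    Markov's inequality it yields the event on which [vfe_upper_bound] applies. *)
Lemma oracle_moment k (Q : probability (param S k) R) c : (1 <= k <= M)%N ->
  lne (\int[Q]_theta expeR (xi3%:E * excess_risk (in_model theta))) <= c%:E ->
  \int[P]_x \int[Q]_theta (expR (lambda * xi2 * loss_diff (in_model theta) x))%:E
    <= (expR c)%:E.
Proof.
move=> kM.
have -> : \int[Q]_theta expeR (xi3%:E * excess_risk (in_model theta)) =
    \int[Q]_theta (expR (xi3 * risk (in_model theta)))%:E.
  apply: eq_integral => theta _.
  by rewrite (excess_riskE xi1_gt0 xi3_gt0 moments)// -EFinM.
have mr : measurable_fun [set: param S k]
    (fun theta => xi3 * risk (in_model theta))%R.
  by apply: measurable_funM => //; exact: measurable_risk.
have i0 := integral_expR_gt0 Q mr.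
rewrite -lee_expeR lneK; last by rewrite in_itv /= leey andbT ltW.
move=> hc; apply: le_trans hc.
have mF : measurable_fun [set: param S k * obs S]
    (fun z : param S k * obs S =>
       (expR (lambda * xi2 * loss_diff (in_model z.1) z.2))%:E).
  apply: measurable_expRE; apply: measurable_funM => //.
  exact: measurable_loss_diff.
rewrite -(fubini_tonelli _ mF) => [|z]; last by rewrite lee_fin expR_ge0.
apply: ge0_le_integral => //.
- by move=> theta _; apply: integral_ge0 => x _; rewrite lee_fin expR_ge0.
- by apply: (measurable_fun_fubini_tonelli_F _ mF) => z; rewrite lee_fin expR_ge0.
- exact: measurable_expRE.
by move=> theta _; exact: (moments_real xi1_gt0 xi3_gt0 moments theta kM).2.
Qed.

End Tempering.

(** * Auxiliary facts on integrals, minima over indices and Gibbs weights *)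

(** The integral is a supremum over the simple functions below, and a larger function has more of
    them. It serves to dominate the posterior mass, as a function of the sample. *)
Lemma ge0_le_integralTW d (T : measurableType d) (R : realType)
    (mu : {measure set T -> \bar R}) (f g : T -> \bar R) :
  (forall x, 0 <= f x) -> (forall x, f x <= g x) ->
  \int[mu]_x f x <= \int[mu]_x g x.
Proof.
move=> f0 fg; have g0 x : 0 <= g x by exact: le_trans (fg x).
rewrite !ge0_integralTE//; apply: le_ereal_sup => _ [h /= hf <-].
by exists h => // x; exact: le_trans (fg x).
Qed.

(** Turns a lower bound on [stop_index] or [near_optimal] into a finite conjunction. *)
Lemma leq_bigminn K m (s : seq nat) (p : pred nat) :
  (K <= \big[minn/m]_(k <- s | p k) k)%N =
  ((K <= m)%N && all (fun k => p k ==> (K <= k)%N) s).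
Proof.
elim: s => [|k s ih] /=; first by rewrite big_nil andbT.
by rewrite big_cons; case: (p k) => //=; rewrite leq_min ih andbCA.
Qed.

Lemma bigminn_mem m (s : seq nat) (p : pred nat) :
  let k := (\big[minn/m]_(k <- s | p k) k)%N in k = m \/ (k \in s) && p k.
Proof.
elim: s => [|k s ih] /=; first by rewrite big_nil; left.
rewrite big_cons; have [pk|pk] := boolP (p k); last first.
  case: ih => [->|/andP[h1 h2]]; [by left|right].
  by rewrite inE h1 orbT.
rewrite /minn; case: ifP => _; first by right; rewrite inE eqxx.
case: ih => [->|/andP[h1 h2]]; [by left|right].
by rewrite inE h1 orbT.
Qed.

Lemma measurable_all d (T : measurableType d) (s : seq nat)
    (f : nat -> T -> bool) :
  (forall k, k \in s -> measurable [set x | f k x]) ->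
  measurable [set x | all (f ^~ x) s].
Proof.
elim: s => [|k s ih] mf /=.
  by have -> : [set x : T | true] = setT by apply/seteqP; split.
have -> : [set x | f k x && all (f ^~ x) s] =
    [set x | f k x] `&` [set x | all (f ^~ x) s].
  by apply/seteqP; split => x /= /andP.
apply: measurableI; first by apply: mf; rewrite inE eqxx.
by apply: ih => j js; apply: mf; rewrite inE js orbT.
Qed.

(* With u = vk - v - ln M, the bound u exp (- u) <= 1 - exp (- u) reads
   p k * u <= exp (- v) / M - p k, and the right-hand sides sum to at most 0. *)
Lemma gibbs_average (R : realType) (m M ks : nat) (p q : nat -> R) (c b v : R) :
  (1 <= ks <= m)%N -> (m <= M)%N -> p ks = expR (- v) ->
  (forall k, (1 <= k <= m)%N -> p k = 0%R \/
    exists vk, p k = expR (- vk) /\ (c * q k <= vk + b)%R) ->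
  (c * \sum_(1 <= k < m.+1) p k / (\sum_(1 <= j < m.+1) p j) * q k
    <= v + b + ln M%:R)%R.
Proof.
move=> /andP[ks1 ksm] mM pks hp.
have M0 : (0 < M%:R :> R)%R by rewrite ltr0n; lia.
set Sp := (\sum_(1 <= j < m.+1) p j)%R.
have p0 k : (1 <= k < m.+1)%N -> (0 <= p k)%R.
  by move=> km; case: (hp k) => [//|->//|[vk [-> _]]]; rewrite expR_ge0.
have SpE : (expR (- v) <= Sp)%R.
  rewrite /Sp (bigD1_seq ks) ?iota_uniq//= ?mem_index_iota ?ks1 ?ltnS//.
  rewrite -pks lerDl big_seq_cond sumr_ge0// => k /andP[km _].
  by apply: p0; rewrite mem_index_iota in km.
have Sp0 : (0 < Sp)%R by apply: lt_le_trans SpE; exact: expR_gt0.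
set D := (v + b + ln M%:R)%R.
have term k : (1 <= k < m.+1)%N ->
    (p k * (c * q k - D) <= expR (- v) / M%:R - p k)%R.
  move=> km; case: (hp k) => [//|->|[vk [-> hk]]].
    by rewrite mul0r subr0 divr_ge0 ?expR_ge0// ltW.
  set u := (vk - v - ln M%:R)%R.
  have -> : (expR (- vk) = expR (- v) / M%:R * expR (- u))%R.
    rewrite -[X in (_ / X)%R]lnK ?posrE// -expRN -!expRD.
    by congr expR; rewrite /u; ring.
  set B := (expR (- v) / M%:R)%R.
  have B0 : (0 < B)%R by rewrite divr_gt0 ?expR_gt0.
  apply: (@le_trans _ _ (B * expR (- u) * u)%R).
    rewrite ler_wpM2l ?mulr_ge0 ?expR_ge0 ?(ltW B0)// /u /D.
    by move: hk; lra.
  rewrite -[X in (_ <= X - _)%R]mulr1 -mulrA -mulrBr ler_pM2l//.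
  have h1 := expR_ge1Dx u.
  have -> : (expR (- u) * u = expR (- u) * (1 + u) - expR (- u))%R by ring.
  have : (expR (- u) * (1 + u) <= expR (- u) * expR u)%R.
    by rewrite ler_wpM2l ?expR_ge0.
  by rewrite -expRD addNr expR0; lra.
(* There are [m <= M] terms [expR (- v) / M], so their sum is at most [expR (- v) = p ks], one of
   the summands of [Sp]. *)
have tot : (\sum_(1 <= k < m.+1) p k * (c * q k - D) <= 0)%R.
  apply: (@le_trans _ _ (\sum_(1 <= k < m.+1) (expR (- v) / M%:R - p k))%R).
    by apply: ler_sum_nat.
  rewrite sumrB -/Sp sumr_const_nat subn1/= subr_le0; apply: le_trans SpE.
  rewrite -(mulr_natr _ m) -mulrA ler_piMr ?expR_ge0//.
  by rewrite mulrC ler_pdivrMr// mul1r ler_nat.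
have -> : (c * (\sum_(1 <= k < m.+1) p k / Sp * q k) =
    (\sum_(1 <= k < m.+1) p k * (c * q k - D)) / Sp + D)%R.
  have -> : (\sum_(1 <= k < m.+1) p k * (c * q k - D) =
     c * (\sum_(1 <= k < m.+1) p k * q k) - Sp * D)%R.
    rewrite mulr_sumr /Sp mulr_suml -sumrB; apply: eq_bigr => k _; ring.
  have -> : (\sum_(1 <= k < m.+1) p k / Sp * q k =
     (\sum_(1 <= k < m.+1) p k * q k) / Sp)%R.
    by rewrite mulr_suml; apply: eq_bigr => k _; ring.
  by field; rewrite gt_eqF.
by rewrite gerDr mulr_le0_ge0// invr_ge0 ltW.
Qed.

(** The Donsker-Varadhan inequality with both functions equal to 0. *)
Lemma KL_ge0 d (T : measurableType d) (R : realType) (Q P : probability T R) :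
  0 <= KL Q P.
Proof.
have := @donsker_varadhan _ T R Q P (cst 0%R) (cst 0%R).
rewrite !(integral_prob_cst Q 0) add0e; apply => //.
have -> : (fun x : T => (expR (cst 0 x - cst 0 x))%:E) = cst 1 :> (T -> \bar R).
  by apply/funext => x; rewrite /= subrr expR0.
by rewrite integral_prob_cst.
Qed.

Lemma markov_max0 d (T : measurableType d) (R : realType) (Q : probability T R)
    (f : T -> R) (t : R) : measurable_fun [set: T] f -> (0 <= t)%R ->
  t%:E * Q [set x | (t <= f x)%R] <= \int[Q]_x (Num.max (f x) 0)%:E.
Proof.
move=> mf t0.
have mB : measurable [set x | (t <= f x)%R].
  rewrite -[X in measurable X]setTI.
  have := mf measurableT `[t, +oo[%classic (measurable_itv _).
  by congr (measurable (_ `&` _)); apply/seteqP; split => x /=;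
    rewrite in_itv /= andbT.
rewrite -(setIT [set x | _]) -integral_indic// -ge0_integralZl//.
- apply: ge0_le_integral => //.
  + by move=> x _; rewrite -EFinM lee_fin mulr_ge0.
  + by apply: measurable_funeM; apply/measurable_EFinP; exact: measurable_indic.
  + by apply/measurable_EFinP; exact: measurable_funrpos.
  + move=> x _; rewrite -EFinM lee_fin indicE.
    case: (boolP (x \in _)) => [/set_mem /= tx|_]; last first.
      by rewrite mulr0 le_max lexx orbT.
    by rewrite mulr1 le_max tx.
- by apply/measurable_EFinP; exact: measurable_indic.
Qed.

(** * The expected posterior mass at a fixed sample size *)

Section OneSample.
Context (R : realType) (S : bayes_setup R).
Local Notation M := (nmodels S).
Local Notation P := (truth S).
Context (lambda rho xi1 xi2 xi3 xi5 : R).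
Context (lambda_gt0 : (0 < lambda)%R) (rho_gt0 : (0 < rho)%R).
Context (xi1_gt0 : (0 < xi1)%R) (xi2_gt0 : (0 < xi2)%R) (xi3_gt0 : (0 < xi3)%R).
Context (xi5_gt0 : (0 < xi5)%R).
Context (Qhat : forall k, obs S -> probability (param S k) R)
  (psihat : forall k, obs S -> hyper S k).
Arguments Qhat : clear implicits.
Arguments psihat : clear implicits.
Local Notation V := (mvfe lambda rho Qhat psihat).
Local Notation stop := (stop_index lambda rho Qhat psihat).

(** The factor of [E + ln M] in the bound on the averaged free energies, over the factor of the
    positive risk. The summands come in turn from the Markov threshold on the evidences, the loss of
    the oracle, its divergence and penalty, and the Gibbs average. *)
Definition rate_constant : R :=
  (((ln 4 + 1) / rbar rho + (xi5 + 1) / xi2 / rbar rho + 2 * xi5 + 1)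
   / (xi1 / 2 / rbar rho))%R.

Let scale_gt0 : (0 < xi1 / 2 / rbar rho)%R.
Proof. by apply: divr_gt0; [exact: divr_gt0|exact: rbar_gt0]. Qed.

Lemma rate_constant_gt0 : (0 < rate_constant)%R.
Proof.
have rb0 := rbar_gt0 rho_gt0.
have l4 : (0 <= ln 4 :> R)%R by rewrite ln_ge0// ler1n.
have h1 : (0 <= (ln 4 + 1) / rbar rho)%R by rewrite divr_ge0 ?addr_ge0 ?(ltW rb0).
have h2 : (0 <= (xi5 + 1) / xi2 / rbar rho)%R.
  apply: divr_ge0; last exact: ltW.
  by apply: divr_ge0; [rewrite addr_ge0// ltW|exact: ltW].
rewrite /rate_constant divr_gt0//.
by move: xi5_gt0; lra.
Qed.

Lemma vfe_ge0 k (Q : probability (param S k) R) psi x : 0 <= vfe lambda rho Q psi x.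
Proof.
rewrite /vfe adde_ge0 ?KL_ge0// mule_ge0//.
  by rewrite lee_fin divr_ge0 ?(ltW lambda_gt0) ?(ltW (rbar_gt0 rho_gt0)).
by apply: integral_ge0 => theta _; rewrite lee_fin loss_ge0.
Qed.

(** Nonnegativity excludes [-oo], and an infinite free energy has weight 0: these are the two
    alternatives in [gibbs_average]. *)
Lemma fine_expeRN_mvfe k x : fine (expeR (- V k x)) = 0%R \/
  exists v, V k x = v%:E /\ fine (expeR (- V k x)) = expR (- v).
Proof.
have : 0 <= V k x by exact: vfe_ge0.
case: (V k x) => [v _| |]//; last by left.
by right; exists v.
Qed.

Lemma fine_expeRN_mvfe_ge0 k x : (0 <= fine (expeR (- V k x)))%R.
Proof. by apply: fine_ge0; exact: expeR_ge0. Qed.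

Lemma stop_index_le x : (stop x <= M)%N.
Proof.
by have := leqnn (stop x); rewrite {2}/stop_index leq_bigminn => /andP[].
Qed.

(** For [K <= M], the index reaches [K] exactly when no free energy increases at an index below [K],
    a finite conjunction of measurable conditions. *)
Lemma measurable_stop_index (K : nat) :
  (forall k, (1 <= k <= M)%N -> measurable_fun [set: obs S] (V k)) ->
  measurable [set x | (K <= stop x)%N].
Proof.
move=> mV.
have [KM|KM] := leqP K M; last first.
  rewrite (_ : [set x | _] = set0)//; apply/seteqP; split => // x /= Kx.
  by have := leq_trans Kx (stop_index_le x); rewrite leqNgt KM.
have -> : [set x | (K <= stop x)%N] = [set x | all (fun k =>
    (V k.-1 x < V k x) ==> (K <= k)%N) (index_iota 2 M.+1)].
  by apply/seteqP; split => x /=; rewrite /stop_index leq_bigminn KM.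
apply: (@measurable_all _ _ _ (fun k x => (V k.-1 x < V k x) ==> (K <= k)%N)).
move=> k; rewrite mem_index_iota => kM.
have [Kk|kK] := boolP (K <= k)%N.
  by rewrite (_ : [set x | _] = setT)//; apply/seteqP; split => x //=;
    rewrite implybT.
have -> : [set x | (V k.-1 x < V k x) ==> false] =
    [set: obs S] `&` [set x | V k x <= V k.-1 x].
  by apply/seteqP; split => x /=; rewrite implybF -leNgt => // -[].
by apply: measurable_lee => //; apply: mV; lia.
Qed.

Context (moments : forall t : all_params S, full_space t ->
  \int[P]_x (expR (- (lambda * loss_diff t x)))%:E
    <= expeR (- (xi1%:E * excess_risk t)) /\
  \int[P]_x (expR (lambda * xi2 * loss_diff t x))%:E
    <= expeR (xi3%:E * excess_risk t)).
Context (minimizer : forall k x, (1 <= k <= M)%N ->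
  eb_minimizer lambda rho x (Qhat k x) (psihat k x)).
Context (measurable_V : forall k, (1 <= k <= M)%N ->
  measurable_fun [set: obs S] (V k)).
Context (cover : forall k, (1 <= k <= M)%N ->
  exists r u : R,
    [/\ (0 < r)%R, (0 < u)%R,
        lne (covering_number (@prior R S k) rho r) <= u%:E
      & (u + rho * r)%:E <= ((2 * rbar rho)^-1)%:E * model_risk S xi1 k]).
Context (oracle : forall k, (1 <= k <= M)%N ->
  exists (Q : probability (param S k) R) (psi : hyper S k),
    [/\ vfamily Q,
        lne (\int[Q]_theta expeR (xi3%:E * excess_risk (in_model theta)))
          <= xi5%:E * model_risk S xi1 k,
        KL Q (prior psi) <= xi5%:E * model_risk S xi1 k
      & (penalty psi)%:E <= xi5%:E * model_risk S xi1 k]).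

(** The positive lower bound in [cover] gives positivity and excludes [-oo]; [+oo] is excluded by
    [model_risk_lty], with [psihat] at an arbitrary sample as hyperparameter. *)
Lemma model_risk_fin k : (1 <= k <= M)%N ->
  exists e, model_risk S xi1 k = e%:E /\ (0 < e)%R.
Proof.
move=> kM; have [r [u [r0 u0 _]]] := cover kM.
have rb20 : (0 < (2 * rbar rho)^-1)%R.
  by rewrite invr_gt0 mulr_gt0// (rbar_gt0 rho_gt0).
have := model_risk_lty xi1_gt0 xi3_gt0 moments (psihat k point) kM.
case: (model_risk S xi1 k) => [e _| |]//.
- rewrite -EFinM lee_fin => h; exists e; split => //.
  rewrite -(pmulr_rgt0 _ rb20); apply: lt_le_trans h.
  by rewrite addr_gt0// mulr_gt0.
- by rewrite gt0_muleNy ?lte_fin// leeNy_eq.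
Qed.

Lemma esa_ge0 x (B : set (all_params S)) : 0 <= esa lambda rho Qhat psihat x B.
Proof.
apply: sume_ge0 => k _; rewrite mule_ge0// lee_fin divr_ge0//.
  exact: fine_expeRN_mvfe_ge0.
by apply: sumr_ge0 => j _; exact: fine_expeRN_mvfe_ge0.
Qed.

Lemma esa_sumE x (B : set (all_params S)) :
  (forall k, (1 <= k <= M)%N -> measurable (@in_model R S k @^-1` B)) ->
  esa lambda rho Qhat psihat x B =
   (\sum_(1 <= k < (stop x).+1) fine (expeR (- V k x)) /
     (\sum_(1 <= j < (stop x).+1) fine (expeR (- V j x)))
     * fine (Qhat k x (@in_model R S k @^-1` B)))%:E.
Proof.
move=> mB; rewrite /esa -sumEFin; apply: eq_big_nat => k kx.
have kM : (1 <= k <= M)%N by have := stop_index_le x; lia.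
by rewrite [RHS]EFinM fineK// fin_num_measure//; exact: mB.
Qed.

(** The weights sum to 1, or to 0 when every free energy up to the stopping index is infinite. *)
Lemma esa_le1 x (B : set (all_params S)) :
  (forall k, (1 <= k <= M)%N -> measurable (@in_model R S k @^-1` B)) ->
  esa lambda rho Qhat psihat x B <= 1.
Proof.
move=> mB; rewrite esa_sumE// lee_fin; set p := fun k => fine (expeR (- V k x)).
set Sp := (\sum_(1 <= j < (stop x).+1) p j)%R.
have Sp0 : (0 <= Sp)%R by apply: sumr_ge0 => k _; exact: fine_expeRN_mvfe_ge0.
have w0 k : (0 <= p k / Sp)%R by rewrite divr_ge0// fine_expeRN_mvfe_ge0.
apply: (@le_trans _ _ (\sum_(1 <= k < (stop x).+1) p k / Sp)%R).
  apply: ler_sum_nat => k kx; rewrite ler_piMr//; first exact: (w0 k).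
  have kM : (1 <= k <= M)%N by have := stop_index_le x; lia.
  by rewrite -lee_fin fineK ?probability_le1 ?fin_num_measure//; exact: mB.
rewrite -mulr_suml -/Sp; have [->|Spn0] := eqVneq Sp 0%R; first by rewrite mul0r.
by rewrite divff.
Qed.

(** Outside three events the posterior mass is at most [rate_constant / a]. These are a stopping
    index below [K], of probability at most [eta], and large values of [W1] or [W2], each of
    probability at most [expR (- E)] by Markov's inequality. *)
Lemma integral_esa_le (K ks : nat) (E a : R) (eta : \bar R) :
  (1 <= ks <= K)%N -> (K <= M)%N -> model_risk S xi1 ks = E%:E ->
  (1 <= E)%R -> (0 < a)%R -> 0 <= eta ->
  1 - eta <= P [set x | (K <= stop x)%N] ->
  \int[P]_x esa lambda rho Qhat psihat x
     [set t | a%:E * (E%:E + (ln M%:R)%:E) <= excess_risk t]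
  <= (rate_constant / a + 2 * expR (- E))%:E + eta.
Proof.
move=> /andP[ks1 ksK] KM risk_ks E1 a0 eta0 stopP.
set B := [set t | _].
have ksM : (1 <= ks <= M)%N by rewrite ks1 (leq_trans ksK).
have M0 : (0 < M)%N by case/andP: ksM => /leq_trans; apply.
have M0R : (0 < M%:R :> R)%R by rewrite ltr0n.
have lnM0 : (0 <= ln M%:R :> R)%R by rewrite ln_ge0// ler1n.
pose t := (a * (E + ln M%:R))%R.
have t0 : (0 < t)%R by rewrite mulr_gt0// ltr_pwDl//; lra.
have rb0 := rbar_gt0 rho_gt0.
have BE k : (1 <= k <= M)%N ->
    @in_model R S k @^-1` B = [set theta | (t <= risk (in_model theta))%R].
  move=> kM; apply/seteqP; split => theta;
  by rewrite /B /preimage /mkset (excess_riskE xi1_gt0 xi3_gt0 moments)//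
    -EFinD -EFinM lee_fin.
have mB k : (1 <= k <= M)%N -> measurable (@in_model R S k @^-1` B).
  move=> kM; rewrite BE// -[X in measurable X]setTI.
  have := measurable_risk kM measurableT (measurable_itv `[t, +oo[).
  by congr (measurable (_ `&` _)); apply/seteqP; split => theta /=;
    rewrite in_itv /= andbT.
have /choice [W hW] : forall k, exists Wk : obs S -> \bar R, (1 <= k <= M)%N ->
   [/\ measurable_fun [set: obs S] Wk, forall x, 0 <= Wk x,
       \int[P]_x Wk x <= 4%:E
     & forall (Q : probability (param S k) R) (psi : hyper S k) (x : obs S) (y : R),
         (0 <= y)%R -> Wk x <= (expR y)%:E ->
         (xi1 / 2 / rbar rho)%:E *
           \int[Q]_theta (Num.max (risk (in_model theta)) 0)%:E
         + (lambda / rbar rho * loss P x)%:E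
         <= vfe lambda rho Q psi x + (y / rbar rho)%:E].
  move=> k; have [kM|kM] := boolP (1 <= k <= M)%N; last by exists (cst 0).
  have [r [u [r0 u0 cov hur]]] := cover kM.
  have [Wk hWk] := vfe_lower_bound lambda_gt0 rho_gt0 xi1_gt0 xi3_gt0 moments
    (psihat k point) kM r0 u0 cov hur.
  by exists Wk.
have [Qs [psis [Qsf Qs_mom Qs_kl Qs_pen]]] := oracle ksM.
move: Qs_mom Qs_kl Qs_pen; rewrite risk_ks -!EFinM => Qs_mom Qs_kl Qs_pen.
pose W2 x := \int[Qs]_theta (expR (lambda * xi2 * loss_diff (in_model theta) x))%:E.
have W2_int : \int[P]_x W2 x <= (expR (xi5 * E))%:E.
  exact: (oracle_moment xi1_gt0 xi3_gt0 moments ksM Qs_mom).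
have W20 x : 0 <= W2 x by apply: integral_ge0 => theta _; rewrite lee_fin expR_ge0.
have mW2 : measurable_fun [set: obs S] W2.
  have mF : measurable_fun [set: param S ks * obs S]
    (fun z : param S ks * obs S =>
       (expR (lambda * xi2 * loss_diff (in_model z.1) z.2))%:E).
    apply: measurable_expRE; apply: measurable_funM => //.
    exact: measurable_loss_diff.
  by apply: (@measurable_fun_fubini_tonelli_G _ _ _ _ _ Qs _ mF) => z;
    rewrite lee_fin expR_ge0.
(* Summing over the models lets one event serve every [k], at the price of a factor [M] that becomes
   [ln M] in the exponent. *)
pose W1 x := \sum_(k <- iota 1 M) (if (1 <= k <= M)%N then W k x else 0).
have mWk k : measurable_fun [set: obs S]
    (fun x => if (1 <= k <= M)%N then W k x else 0).
  by case: (boolP (1 <= k <= M)%N) => // kM; have [] := hW _ kM.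
have Wk0 k x : 0 <= (if (1 <= k <= M)%N then W k x else 0).
  by case: (boolP (1 <= k <= M)%N) => // kM; have [_ ->] := hW _ kM.
have W10 x : 0 <= W1 x by apply: sume_ge0.
have mW1 : measurable_fun [set: obs S] W1 by exact: emeasurable_sum.
have W1_int : \int[P]_x W1 x <= (4 * M%:R)%:E.
  rewrite ge0_integral_sum//.
  apply: (@le_trans _ _ (\sum_(k <- iota 1 M) 4%:E)).
    apply: lee_sum => k _; case: (boolP (1 <= k <= M)%N) => kM.
      by have [] := hW _ kM.
    by rewrite (integral_prob_cst P 0).
  rewrite sumEFin lee_fin big_const_seq count_predT size_iota iter_addr_0.
  by rewrite mulr_natr.
have W_le k x : (1 <= k <= M)%N -> W k x <= W1 x.
  move=> kM; rewrite /W1 (bigD1_seq k) ?iota_uniq ?mem_iota ?add1n ?ltnS//.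
  by rewrite kM leeDl// sume_ge0.
have mG := measurable_stop_index K measurable_V.
set G := [set x | (K <= stop x)%N] in stopP mG.
have key x : G x -> W1 x <= (4 * M%:R * expR E)%:E ->
    W2 x <= (expR (xi5 * E + E))%:E ->
    esa lambda rho Qhat psihat x B <= (rate_constant / a)%:E.
  move=> Gx W1x W2x.
  rewrite esa_sumE// lee_fin.
  have stopM := stop_index_le x.
  have y0 : (0 <= ln (4 * M%:R) + E)%R.
    rewrite addr_ge0 ?ln_ge0//; last by lra.
    by have : (1 <= M%:R :> R)%R; [rewrite ler1n|lra].
  have expy : expR (ln (4 * M%:R) + E) = (4 * M%:R * expR E)%R.
    by rewrite expRD lnK// posrE mulr_gt0.
  have w0 : (0 <= xi5 * E + E)%R by rewrite addr_ge0 ?mulr_ge0 ?(ltW xi5_gt0)//; lra.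
  have upper := vfe_upper_bound lambda_gt0 rho_gt0 xi2_gt0 ksM w0 W2x.
  set c0 := (lambda / rbar rho * loss P x)%R in upper.
  set c1 := ((xi5 * E + E) / xi2 / rbar rho)%R in upper.
  (* Minimality is tested against the oracle pair. The penalty of the minimizer is dropped; the two
     terms [xi5 * E] bound the divergence and the penalty of the oracle. *)
  have Vks : V ks x <= (c0 + c1 + xi5 * E + xi5 * E)%:E.
    have [_ /(_ Qs psis Qsf)] := minimizer x ksM.
    rewrite -/(mvfe _ _ _ _ _ _) => hmin.
    apply: (@le_trans _ _ (V ks x + (penalty (psihat ks x))%:E)).
      by rewrite leeDl// lee_fin penalty_ge0.
    apply: (le_trans hmin); rewrite (EFinD (_ + _)) leeD//.
    by rewrite EFinD /vfe leeD.
  have [v Vv] : exists v, V ks x = v%:E.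
    have : 0 <= V ks x by exact: vfe_ge0.
    by case: (V ks x) Vks => [v| |]//; exists v.
  move: Vks; rewrite Vv lee_fin => v_le.
  pose y := (ln (4 * M%:R) + E)%R.
  (* The masses of [B] are averaged, Markov's inequality having been applied inside each model. The
     true loss [c0] enters with a minus sign and cancels the one in the bound on [v]. *)
  have := @gibbs_average R (stop x) M ks (fun k => fine (expeR (- V k x)))
    (fun k => fine (Qhat k x (@in_model R S k @^-1` B)))
    (xi1 / 2 / rbar rho * t)%R (y / rbar rho - c0)%R v.
  rewrite ks1 (leq_trans ksK Gx) => /(_ isT stopM).
  rewrite Vv /= => /(_ erefl); set q := (\sum_(1 <= k < _) _)%R => gibbs.
  have {}gibbs : (xi1 / 2 / rbar rho * t * q <= v + (y / rbar rho - c0) + ln M%:R)%R.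
    apply: gibbs => k kx.
    have kM : (1 <= k <= M)%N by case/andP: kx => -> /leq_trans; apply.
    case: (fine_expeRN_mvfe k x) => [->|[vk [Vk ->]]]; [by left|right].
    exists vk; split => //.
    have [_ _ _ /(_ (Qhat k x) (psihat k x) x y y0)] := hW _ kM.
    rewrite expy => /(_ (le_trans (W_le k x kM) W1x)).
    rewrite -/(mvfe _ _ _ _ _ _) Vk -/c0 => low.
    have mk := markov_max0 (Qhat k x) (measurable_risk kM) (ltW t0).
    rewrite -BE// in mk.
    have : ((xi1 / 2 / rbar rho * t) * fine (Qhat k x (@in_model R S k @^-1` B)))%:E
       + c0%:E <= vk%:E + (y / rbar rho)%:E.
      apply: le_trans low; rewrite leeD2r// -mulrA !EFinM.
      rewrite lee_wpmul2l ?lee_fin ?(ltW scale_gt0)//.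
      by rewrite fineK// fin_num_measure//; exact: mB.
    by rewrite -!EFinD lee_fin; lra.
  have q_le : (xi1 / 2 / rbar rho * t * q <=
      rate_constant * (xi1 / 2 / rbar rho) * (E + ln M%:R))%R.
    apply: (le_trans gibbs).
    rewrite /rate_constant divfK; last by rewrite gt_eqF.
    have l4 : (0 <= ln 4 :> R)%R by rewrite ln_ge0// ler1n.
    (* The constant [ln 4] is absorbed by [1 <= E]. *)
    have yE : (y <= (ln 4 + 1) * (E + ln M%:R))%R.
      rewrite /y lnM ?posrE//.
      have : (0 <= ln 4 * (E - 1))%R by rewrite mulr_ge0// subr_ge0.
      have : (0 <= ln 4 * ln M%:R :> R)%R by rewrite mulr_ge0.
      by lra.
    have {}yE : (y / rbar rho <= (ln 4 + 1) / rbar rho * (E + ln M%:R))%R.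
      by rewrite mulrAC ler_pM2r ?invr_gt0.
    have cE : (c1 <= (xi5 + 1) / xi2 / rbar rho * (E + ln M%:R))%R.
      have -> : c1 = ((xi5 + 1) / xi2 / rbar rho * E)%R by rewrite /c1; ring.
      rewrite ler_wpM2l ?lerDl//; apply: divr_ge0; last exact: ltW.
      by apply: divr_ge0; [rewrite addr_ge0// ltW|exact: ltW].
    have xE : (0 <= xi5 * ln M%:R)%R by rewrite mulr_ge0// ltW.
    by lra.
  rewrite ler_pdivlMr//.
  have El0 : (0 < E + ln M%:R)%R by lra.
  rewrite -(ler_pM2r El0) -(ler_pM2r scale_gt0).
  have -> : (q * a * (E + ln M%:R) * (xi1 / 2 / rbar rho) =
    xi1 / 2 / rbar rho * t * q)%R by rewrite /t; ring.
  by rewrite [leRHS]mulrAC.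
(* Reciprocals of the two thresholds: [d1 * W1] or [d2 * W2] is at least 1 on the corresponding
   exceptional event, where the posterior mass is at most 1, so that [g] dominates the mass
   everywhere. *)
pose d1 := (expR (- E) / (4 * M%:R))%R.
pose d2 := expR (- (xi5 * E + E)).
have d10 : (0 <= d1)%R by rewrite divr_ge0 ?expR_ge0 ?mulr_ge0.
have d20 : (0 <= d2)%R by rewrite expR_ge0.
have c0 : (0 <= rate_constant / a)%R by rewrite divr_ge0// ltW// rate_constant_gt0.
have mGC : measurable (~` G) by exact: measurableC.
pose g x := (rate_constant / a)%:E + ((\1_(~` G) x)%:E + (d1%:E * W1 x + d2%:E * W2 x)).
have m1 : measurable_fun [set: obs S] (fun x => d1%:E * W1 x) by exact: measurable_funeM.
have m2 : measurable_fun [set: obs S] (fun x => d2%:E * W2 x) by exact: measurable_funeM.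
have i1 x : 0 <= d1%:E * W1 x by rewrite mule_ge0.
have i2 x : 0 <= d2%:E * W2 x by rewrite mule_ge0.
have i3 x : 0 <= (\1_(~` G) x)%:E :> \bar R by rewrite lee_fin.
have m3 : measurable_fun [set: obs S] (fun x => (\1_(~` G) x)%:E : \bar R).
  by apply/measurable_EFinP; exact: measurable_indic.
apply: (@le_trans _ _ (\int[P]_x g x)).
  apply: ge0_le_integralTW => x; [exact: esa_ge0|have e1 := esa_le1 x mB].
  have [Gx|nGx] := pselect (G x); last first.
    apply: (le_trans e1); rewrite /g.
    have -> : (\1_(~` G) x)%:E = 1 :> \bar R by rewrite indicE mem_set.
    by rewrite addeCA leeDl// !adde_ge0// lee_fin.
  have [W1x|W1x] := leP (W1 x) (4 * M%:R * expR E)%:E; last first.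
    apply: (le_trans e1); rewrite /g.
    apply: (@le_trans _ _ (d1%:E * W1 x)).
      apply: (@le_trans _ _ (d1%:E * (4 * M%:R * expR E)%:E)).
        rewrite -EFinM lee_fin /d1 mulrA divfK ?gt_eqF ?mulr_gt0//.
        by rewrite -expRD addNr expR0.
      by rewrite lee_wpmul2l// ltW.
    apply: (@le_trans _ _ (d1%:E * W1 x + d2%:E * W2 x)); first by rewrite leeDl.
    by rewrite addeA leeDr// adde_ge0// lee_fin.
  have [W2x|W2x] := leP (W2 x) (expR (xi5 * E + E))%:E; last first.
    apply: (le_trans e1); rewrite /g.
    apply: (@le_trans _ _ (d2%:E * W2 x)).
      apply: (@le_trans _ _ (d2%:E * (expR (xi5 * E + E))%:E)).
        by rewrite -EFinM lee_fin /d2 -expRD addNr expR0.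
      by rewrite lee_wpmul2l// ltW.
    by rewrite !addeA leeDr// !adde_ge0// lee_fin.
  by apply: (le_trans (key x Gx W1x W2x)); rewrite /g leeDl// !adde_ge0.
have i12 x : 0 <= d1%:E * W1 x + d2%:E * W2 x by rewrite adde_ge0.
have m12 : measurable_fun [set: obs S] (fun x => d1%:E * W1 x + d2%:E * W2 x).
  exact: emeasurable_funD.
have i312 x : 0 <= (\1_(~` G) x)%:E + (d1%:E * W1 x + d2%:E * W2 x) by rewrite adde_ge0.
rewrite /g (ge0_integralD P measurableT (f1 := cst (rate_constant / a)%:E))//;
  last exact: emeasurable_funD.
rewrite integral_prob_cst ge0_integralD// ge0_integralD// !ge0_integralZl//.
rewrite integral_indic// setIT EFinD -addeA leeD2l// addeC leeD//.
  apply: (@le_trans _ _ (d1%:E * (4 * M%:R)%:E + d2%:E * (expR (xi5 * E))%:E)).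
    by rewrite leeD// lee_wpmul2l.
  rewrite -!EFinM -EFinD lee_fin /d1 /d2 divfK ?gt_eqF ?mulr_gt0//.
  rewrite -expRD.
  have -> : (- (xi5 * E + E) + xi5 * E = - E)%R by ring.
  by lra.
apply: (@le_trans _ _ (1 - P G)).
  by rewrite le_eqVlt; apply/orP; left; apply/eqP; exact: (probability_setC P).
have PG : P G \is a fin_num by rewrite fin_num_measure.
case: eta eta0 stopP => [e| |]// _.
  rewrite -(fineK PG) -!EFinB !lee_fin; lra.
by rewrite leey.
Qed.

End OneSample.

(** * The near-optimal index and the best risk *)

Lemma bigmin_ereal_mem (R : realType) (s : seq nat) (p : pred nat)
    (F : nat -> \bar R) :
  let e := \big[Order.min/+oo]_(k <- s | p k) F k in
  e = +oo \/ exists k, [/\ k \in s, p k & e = F k].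
Proof.
elim: s => [|k s ih] /=; first by rewrite big_nil; left.
rewrite big_cons; have [pk|pk] := boolP (p k); last first.
  case: ih => [->|[j [js pj ->]]]; [by left|right].
  by exists j; split => //; rewrite inE js orbT.
rewrite /Order.min; case: ifP => _; first by right; exists k; rewrite inE eqxx.
case: ih => [->|[j [js pj ->]]]; [by left|right].
by exists j; split => //; rewrite inE js orbT.
Qed.

Section NearOptimal.
Context (R : realType) (S : bayes_setup R) (xi1 tau : R).
Local Notation M := (nmodels S).
Local Notation mrisk k := (model_risk S xi1 k).
Local Notation K := (near_optimal S xi1 tau).
Context (tau_gt0 : (0 < tau)%R).
Context (risk_fin : forall k, (1 <= k <= M)%N ->
  exists e, mrisk k = e%:E /\ (0 < e)%R).

Lemma near_optimal_bounds : (1 <= K <= M)%N.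
Proof.
have := @bigminn_mem M (index_iota 1 M)
  (fun k => mrisk k <= (1 + tau)%:E * mrisk k.+1).
rewrite -/(near_optimal S xi1 tau); case=> [->|/andP[]].
  by rewrite nmodels_gt0 leqnn.
by rewrite mem_index_iota => /andP[-> /ltnW ->].
Qed.

(** Below the near-optimal index the test fails, so the next risk is smaller by a factor greater
    than [1 + tau]. *)
Lemma near_optimal_step k : (1 <= k < K)%N -> mrisk k.+1 <= mrisk k.
Proof.
move=> /andP[k1 kK]; have /andP[K1 KM] := near_optimal_bounds.
have kM : (k < M)%N by exact: leq_trans kK KM.
have [e1 [r1 e10]] : exists e, mrisk k.+1 = e%:E /\ (0 < e)%R by exact: risk_fin.
have [e2 [r2 e20]] : exists e, mrisk k = e%:E /\ (0 < e)%R.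
  by apply: risk_fin; rewrite k1 ltnW.
have := leqnn K; rewrite {2}/near_optimal leq_bigminn => /andP[_ /allP /(_ k)].
rewrite mem_index_iota k1 kM => /(_ isT).
rewrite leqNgt kK implybF -ltNge r1 r2 -EFinM lte_fin lee_fin => /ltW; apply: le_trans.
by rewrite ler_peMl ?lerDl ?ltW.
Qed.

Lemma near_optimal_le k : (1 <= k <= K)%N -> mrisk K <= mrisk k.
Proof.
move=> /andP[k1 kK].
suff h j : (k + j <= K)%N -> mrisk (k + j)%N <= mrisk k.
  by have := h (K - k)%N; rewrite subnKC//; apply.
elim: j => [|j ih]; first by rewrite addn0.
rewrite addnS => kjK; apply: le_trans (ih (ltnW kjK)).
by apply: near_optimal_step; rewrite kjK andbT (leq_trans k1)// leq_addr.
Qed.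

Lemma near_optimal_succ : (K < M)%N -> mrisk K <= (1 + tau)%:E * mrisk K.+1.
Proof.
move=> KM; have := @bigminn_mem M (index_iota 1 M)
  (fun k => mrisk k <= (1 + tau)%:E * mrisk k.+1).
rewrite -/(near_optimal S xi1 tau); case=> [KE|/andP[]//].
by move: KM; rewrite {1}KE ltnn.
Qed.

(** The last inequality follows from monotonicity when the best index is at most [K], and from the
    definition of [K] when it is [K.+1]. Through it the stopping error controls the best risk. *)
Lemma best_risk_attained : exists ks E EK,
  [/\ (1 <= ks <= minn K.+1 M)%N, mrisk ks = E%:E,
      best_risk S xi1 tau = E%:E, mrisk K = EK%:E & (EK <= (1 + tau) * E)%R].
Proof.
have /andP[K1 KM] := near_optimal_bounds.
have [EK [rK EK0]] := risk_fin near_optimal_bounds.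
have := @bigmin_ereal_mem R (index_iota 1 M.+1) (fun k => (k <= K.+1)%N)
  (fun k => mrisk k).
rewrite -/(best_risk S xi1 tau) /=; case=> [bE|[ks [ksM ksK ->]]].
  have : best_risk S xi1 tau <= mrisk K.
    apply: ge_bigmin_seq => //; first by rewrite mem_index_iota K1 ltnS.
  by rewrite bE rK leye_eq.
move: ksM; rewrite mem_index_iota ltnS => /andP[ks1 ksM].
have [E [rE E0]] : exists e, mrisk ks = e%:E /\ (0 < e)%R.
  by apply: risk_fin; rewrite ks1.
exists ks, E, EK; split => //; first by rewrite ks1 leq_min ksK.
have [ksK'|Kks] := leqP ks K.
  have := near_optimal_le (introT andP (conj ks1 ksK')).
  rewrite rK rE lee_fin => /le_trans; apply.
  by rewrite ler_peMl ?lerDl ?ltW.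
have ksE : ks = K.+1 by apply/eqP; rewrite eqn_leq ksK.
have := near_optimal_succ; rewrite -ksE rK rE -EFinM lee_fin; apply.
by rewrite (leq_trans _ ksM)// ksE.
Qed.

(** The prefactor [K] is at least 1. Hence, for positive [C4], a small stopping error forces a large
    risk at [K]. *)
Lemma stop_error_ge C4 EK : mrisk K = EK%:E ->
  (expR (- (C4 * EK)))%:E <= stop_error S xi1 tau C4.
Proof.
move=> rK; rewrite /stop_error rK.
rewrite -[expeR _]/(expR (- (C4 * EK)))%:E -EFinM lee_fin.
rewrite ler_peMl ?expR_ge0// ler1n.
by have /andP[] := near_optimal_bounds.
Qed.

End NearOptimal.

(** * Passage to the limit *)

Theorem theorem4p2 (R : realType) (S : nat -> bayes_setup R)
  (lambda rho : R) (lambda_gt0 : (0 < lambda)%R) (rho_gt0 : (0 < rho)%R)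
  (Qhat : forall n k, obs (S n) -> probability (param (S n) k) R)
  (psihat : forall n k, obs (S n) -> hyper (S n) k)
  (Qhat_psihat_min : forall n k x, (1 <= k <= nmodels (S n))%N ->
     eb_minimizer lambda rho x (Qhat n k x) (psihat n k x))
  (measurable_Qhat : forall n k, (1 <= k <= nmodels (S n))%N ->
     forall B, measurable B ->
     measurable_fun [set: obs (S n)] (fun x => Qhat n k x B))
  (measurable_mvfe : forall n k, (1 <= k <= nmodels (S n))%N ->
     measurable_fun [set: obs (S n)] (mvfe lambda rho (Qhat n) (psihat n) k))
  (xi1 xi2 xi3 : R)
  (xi1_gt0 : (0 < xi1)%R) (xi2_gt0 : (0 < xi2)%R) (xi3_gt0 : (0 < xi3)%R)
  (cond_i : \forall n \near \oo, forall t, full_space t ->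
     \int[truth (S n)]_x (expR (- (lambda * loss_diff t x)))%:E
       <= expeR (- (xi1%:E * excess_risk t)) /\
     \int[truth (S n)]_x (expR (lambda * xi2 * loss_diff t x))%:E
       <= expeR (xi3%:E * excess_risk t))
  (cond_ii : \forall n \near \oo, forall k, (1 <= k <= nmodels (S n))%N ->
     exists r u : R,
       [/\ (0 < r)%R, (0 < u)%R,
           lne (covering_number (@prior R (S n) k) rho r) <= u%:E
         & (u + rho * r)%:E <=
             ((2 * rbar rho)^-1)%:E * model_risk (S n) xi1 k])
  (xi5 : R) (xi5_gt0 : (0 < xi5)%R)
  (cond_iii : \forall n \near \oo, forall k, (1 <= k <= nmodels (S n))%N ->
     exists (Q : probability (param (S n) k) R) (psi : hyper (S n) k),
       [/\ vfamily Q,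
           lne (\int[Q]_theta expeR (xi3%:E * excess_risk (in_model theta)))
             <= xi5%:E * model_risk (S n) xi1 k,
           KL Q (prior psi) <= xi5%:E * model_risk (S n) xi1 k
         & (penalty psi)%:E <= xi5%:E * model_risk (S n) xi1 k])
  (tau C4 : R) (tau_gt0 : (0 < tau)%R) (C4_gt0 : (0 < C4)%R)
  (stop_prob : \forall n \near \oo,
     1 - stop_error (S n) xi1 tau C4 <=
     truth (S n) [set x | (minn (near_optimal (S n) xi1 tau).+1 (nmodels (S n))
                   <= stop_index lambda rho (Qhat n) (psihat n) x)%N])
  (stop_error_cvg0 : stop_error (S n) xi1 tau C4 @[n --> \oo] --> 0)
  (A : nat -> R) (A_cvgy : A n @[n --> \oo] --> +oo%R) :
  \int[truth (S n)]_x
    esa lambda rho (Qhat n) (psihat n) x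
      [set t | (A n)%:E *
          (best_risk (S n) xi1 tau + (ln (nmodels (S n))%:R)%:E)
          <= excess_risk t] @[n --> \oo] --> 0.
Proof.
have rc0 : (0 < rate_constant rho xi1 xi2 xi5)%R by exact: rate_constant_gt0.
set I := fun n => \int[truth (S n)]_x _.
have I0 n : 0 <= I n by apply: integral_ge0 => x _; exact: esa_ge0.
suff small (e : R) : (0 < e)%R -> \forall n \near \oo, I n <= e%:E.
  apply/fine_cvgP; split.
    near=> n; rewrite ge0_fin_numE//.
    have h : I n <= 1%:E by near: n; exact: small.
    by rewrite (le_lt_trans h) ?ltry.
  apply/cvgr0Pnorm_le => e e0; near=> n.
  have h : I n <= e%:E by near: n; exact: small.
  have fI : I n \is a fin_num by rewrite ge0_fin_numE// (le_lt_trans h) ?ltry.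
  by rewrite /= ger0_norm ?fine_ge0// -lee_fin fineK.
(* Once [L <= E], both [1 <= E] and [expR (- E) <= e / 6] hold. *)
move=> e0; pose L := Num.max 1%R (- ln (e / 6))%R.
have e6 : (0 < e / 6)%R by rewrite divr_gt0.
(* The second member forces [L <= E], since the stopping error is at least [expR (- (C4 * EK))] with
   [EK <= (1 + tau) * E]. *)
pose d := Num.min (e / 3)%R (expR (- (C4 * ((1 + tau) * L)))).
have d0 : (0 < d)%R by rewrite lt_min divr_gt0// expR_gt0.
apply: filter_app cond_i; apply: filter_app cond_ii; apply: filter_app cond_iii.
apply: filter_app stop_prob; near=> n => stop orac cov mom.
have eta_lt : stop_error (S n) xi1 tau C4 < d%:E.
  near: n; apply: (stop_error_cvg0 [set x | x < d%:E]).
  by apply: open_ereal_lt'; rewrite lte_fin.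
have An : (Num.max 1 (3 * rate_constant rho xi1 xi2 xi5 / e) <= A n)%R.
  by near: n; exact: (cvgryPge _).1.
have risk_fin := model_risk_fin rho_gt0 xi1_gt0 xi3_gt0 (psihat n) mom cov.
have [ks [E [EK [ksK rks bE rK EKE]]]] := best_risk_attained tau_gt0 risk_fin.
have eta_ge := stop_error_ge C4 rK.
have eta0 : 0 <= stop_error (S n) xi1 tau C4.
  by apply: le_trans eta_ge; rewrite lee_fin expR_ge0.
have tau1 : (0 < 1 + tau)%R by rewrite addr_gt0.
have LE : (L <= E)%R.
  rewrite -(ler_pM2l tau1); apply: le_trans EKE; rewrite -(ler_pM2l C4_gt0) -lerN2.
  rewrite -ler_expR -lee_fin; apply: (le_trans eta_ge); apply/ltW/(lt_le_trans eta_lt).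
  by rewrite lee_fin ge_min lexx orbT.
have E1 : (1 <= E)%R by apply: le_trans LE; rewrite le_max lexx.
have a1 : (1 <= A n)%R by apply: le_trans An; rewrite le_max lexx.
have a0 : (0 < A n)%R by exact: lt_le_trans a1.
have mV k : (1 <= k <= nmodels (S n))%N ->
    measurable_fun [set: obs (S n)] (mvfe lambda rho (Qhat n) (psihat n) k).
  exact: measurable_mvfe.
have bound := integral_esa_le lambda_gt0 rho_gt0 xi1_gt0 xi2_gt0 xi3_gt0 xi5_gt0
  mom (Qhat_psihat_min n) mV cov orac ksK (geq_minr _ _) rks E1 a0 eta0 stop.
rewrite /I bE; apply: (le_trans bound).
(* One third of [e] each for the rate term, the two Markov events together, and the stopping
   error. *)
apply: (@le_trans _ _ ((e / 3 + e / 3)%:E + (e / 3)%:E)).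
  rewrite leeD//; last first.
    by apply/ltW/(lt_le_trans eta_lt); rewrite lee_fin ge_min lexx.
  rewrite lee_fin lerD//.
    have : (3 * rate_constant rho xi1 xi2 xi5 / e <= A n)%R.
      by apply: le_trans An; rewrite le_max lexx orbT.
    rewrite ler_pdivrMr// => rcA.
    by rewrite (ler_pdivrMr _ _ a0); lra.
  have : (expR (- E) <= e / 6)%R.
    rewrite -[leRHS]lnK ?posrE// ler_expR lerNl.
    by apply: le_trans LE; rewrite le_max lexx orbT.
  by lra.
by rewrite -EFinD lee_fin; lra.
Unshelve. all: by end_near.
Qed.
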